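(* Let $X$ be a non-zero real or complex Banach space. If a norm-closed algebra $A\subset\mathcal{B}(X)$ does not contain non-zero finite rank operators, then it has a resolving vector functional, i.e. there are non-zero $x\in X^{**}$ and $y\in X^*$ such that $|(x,T^*y)|\le\|T\|_e\,(x,y)$ for all $T\in A$.
   Context: $\mathcal{B}(X)$ is the algebra of all bounded linear operators on $X$ and $\mathcal{K}(X)$ is the ideal of compact operators. The essential norm of $T\in\mathcal{B}(X)$ is $\|T\|_e=\inf\{\|T+K\|:K\in\mathcal{K}(X)\}$. $T^*\in\mathcal{B}(X^* )$ denotes the adjoint operator, and $(x,y)$ for $x\in X^{**}$, $y\in X^*$ denotes the value $x(y)$. An algebra of operators (a subalgebra of $\mathcal{B}(X)$ over the scalar field of $X$) is not assumed to contain the identity operator. *)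

(* Defs.v *)
From HB Require Import structures.
From mathcomp Require Import all_boot all_order all_algebra.
From mathcomp Require Import complex.
From mathcomp Require Import all_classical all_reals all_analysis.

Set Implicit Arguments.
Unset Strict Implicit.
Unset Printing Implicit Defensive.

Import Order.TTheory GRing.Theory Num.Theory.
Import numFieldNormedType.Exports.

Local Open Scope classical_set_scope.
Local Open Scope ring_scope.

Variant scalar_kind := RealScalars | ComplexScalars.

(* The order and the norm of [R[i]] take values in [R[i]] itself: [a <= b] means
   that [b - a] is a nonnegative real number, and [`|a|] is the modulus of [a]
   seen in [R[i]]. *)
Definition scalars (R : realType) (k : scalar_kind) : numFieldType :=
  match k with
  | RealScalars => R : numFieldType
  | ComplexScalars => R[i] : numFieldType
  end.

Lemma supremums_scalars (R : realType) k (E : set (scalars R k)) M :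
  E !=set0 -> (forall a, E a -> 0 <= a) -> (forall a, E a -> a <= M) ->
  supremums E !=set0.
Proof.
case: k E M => /= E M [a0 Ea0] E0 EM.
  have hE : has_sup E by split; [exists a0 | exists M].
  exists (reals.sup E); split; first exact: sup_upper_bound.
  by move=> b Eb; apply: ge_sup => //; exists a0.
pose S := [set complex.Re a | a in E].
have EC a : E a -> a = (complex.Re a)%:C%C.
  move=> /E0; rewrite lecE => /andP[/eqP /= a0' _].
  by case: a a0' => u v /= ->.
have hS : has_sup S.
  split; first by exists (complex.Re a0), a0.
  exists (complex.Re M) => _ [a Ea <-].
  by have := EM _ Ea; rewrite lecE => /andP[].
exists (reals.sup S)%:C%C; split => [a Ea|b Eb].
  rewrite (EC _ Ea) lecE /= eqxx /=.
  by apply: sup_upper_bound => //; exists a.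
rewrite lecE; apply/andP; split => /=.
  have := Eb _ Ea0; rewrite (EC _ Ea0) lecE => /andP[/eqP -> _].
  by [].
apply: ge_sup => [|_ [a Ea <-]]; first by exists (complex.Re a0), a0.
by have := Eb _ Ea; rewrite lecE => /andP[].
Qed.

Lemma infimums_scalars (R : realType) k (E : set (scalars R k)) :
  E !=set0 -> (forall a, E a -> 0 <= a) -> infimums E !=set0.
Proof.
move=> [a0 Ea0] E0; pose L := [set l | lbound E l /\ 0 <= l].
have [|a []//|a [aE _]|s [sL Ls]] := @supremums_scalars R k L a0.
- by exists 0; split.
- exact: aE.
have lsE : lbound E s by move=> a Ea; apply: Ls => l [lE _]; exact: lE.
have s0 : 0 <= s by apply: sL; split.
exists s; split => // l lE.
have lr : l \is Num.real.
  by rewrite -[l](subKr a0) rpredB// ger0_real ?subr_ge0 ?E0//; exact: lE.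
have [l0|/ltW l0] := real_leP (real0 _) lr; first by apply: sL; split.
exact: le_trans l0 s0.
Qed.

Section bounded_operators.
Context {R : realType} {k : scalar_kind}.
Local Notation K := (scalars R k).

Section type.
Variables X Y : normedModType K.

Definition bounded_linear : {pred X -> Y} :=
  [pred f : X -> Y | `[< linear f /\ continuous f >]].

Record bounded_operator := BoundedOperator {
  operator_fun :> X -> Y;
  _ : operator_fun \in bounded_linear }.

HB.instance Definition _ := [isSub for operator_fun].
HB.instance Definition _ := [Choice of bounded_operator by <:].

Lemma bounded_linear_submod : submod_closed bounded_linear.
Proof.
split => [|a f g /asboolP[lf cf] /asboolP[lg cg]]; apply/asboolP; split.
- by move=> b x y; rewrite /= scaler0 addr0.
- exact: cst_continuous.
- move=> b x y; rewrite -[LHS]/(a *: f (b *: x + y) + g (b *: x + y)).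
  rewrite -[RHS]/(b *: (a *: f x + g x) + (a *: f y + g y)).
  by rewrite lf lg !scalerDr addrACA !scalerA mulrC.
- by move=> x; apply: cvgD; [apply: cvgZr; exact: cf|exact: cg].
Qed.

HB.instance Definition _ :=
  GRing.isSubmodClosed.Build _ _ bounded_linear bounded_linear_submod.
HB.instance Definition _ := [SubChoice_isSubLmodule of bounded_operator by <:].

Implicit Types T S : bounded_operator.

Lemma operator_linear T : linear T.
Proof. by case: T => f /= /asboolP[]. Qed.

Lemma operator_continuous T : continuous T.
Proof. by case: T => f /= /asboolP[]. Qed.

HB.instance Definition _ T :=
  GRing.isLinear.Build K X Y *:%R (operator_fun T) (operator_linear T).

Definition opnorm T : K :=
  supremum 0 [set `|T x| | x in [set x : X | `|x| <= 1]].

Lemma opnorm_supremums T :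
  supremums [set `|T x| | x in [set x : X | `|x| <= 1]] !=set0.
Proof.
have /continuous_linear_bounded-/(_ (0 : X)) := @operator_continuous T 0.
move=> /linear_boundedP /pinfty_ex_gt0[M M0 TM].
apply: (@supremums_scalars _ _ _ M).
- by exists `|T 0|, 0 => //=; rewrite normr0.
- by move=> _ [x _ <-].
- move=> _ [x /= x1 <-]; apply: (le_trans (TM x)).
  by rewrite -[leRHS]mulr1 ler_pM2l.
Qed.

Lemma opnormE T :
  supremums [set `|T x| | x in [set x : X | `|x| <= 1]] (opnorm T).
Proof.
rewrite /opnorm /supremum; case: ifPn => [/eqP E0|_].
  suff : [set `|T x| | x in [set x : X | `|x| <= 1]] `|T 0| by rewrite E0.
  by exists 0 => //=; rewrite normr0.
by case: xgetP => [y -> //|E0]; have [y /E0] := opnorm_supremums T.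
Qed.

Lemma opnorm_ubound T x : `|x| <= 1 -> `|T x| <= opnorm T.
Proof. by move=> x1; apply: (opnormE T).1; exists x. Qed.

Lemma opnorm_le T (M : K) :
  (forall x, `|x| <= 1 -> `|T x| <= M) -> opnorm T <= M.
Proof. by move=> TM; apply: (opnormE T).2 => _ [x /TM ? <-]. Qed.

Lemma opnorm_ge0 T : 0 <= opnorm T.
Proof. by apply: le_trans (@opnorm_ubound T 0 _); rewrite ?normr0. Qed.

Lemma opnormP T x : `|T x| <= opnorm T * `|x|.
Proof.
have [->|x0] := eqVneq x 0; first by rewrite linear0 !normr0 mulr0.
have nx : 0 < `|x| by rewrite normr_gt0.
rewrite -ler_pdivrMr // -[_ / _]mulrC -[X in X * _]gtr0_norm ?invr_gt0//.
rewrite -normrZ -linearZ; apply: opnorm_ubound.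
by rewrite normrZ gtr0_norm ?invr_gt0// mulVf ?gt_eqF.
Qed.

Lemma ler_opnormD T S : opnorm (T + S) <= opnorm T + opnorm S.
Proof.
apply: opnorm_le => x x1; apply: le_trans (ler_normD _ _) _.
by apply: lerD; exact: opnorm_ubound.
Qed.

Let opnormZ_le (a : K) T : opnorm (a *: T) <= `|a| * opnorm T.
Proof.
apply: opnorm_le => x x1; rewrite -[(a *: T) x]/(a *: T x) normrZ.
by apply: ler_wpM2l => //; exact: opnorm_ubound.
Qed.

Lemma opnormZ (a : K) T : opnorm (a *: T) = `|a| * opnorm T.
Proof.
have [->|a0] := eqVneq a 0.
  apply/eqP; rewrite normr0 mul0r eq_le opnorm_ge0 andbT.
  by have := opnormZ_le 0 T; rewrite normr0 mul0r.
apply/eqP; rewrite eq_le opnormZ_le /=.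
rewrite -ler_pdivlMl ?normr_gt0// -normfV -[in leLHS](scalerK a0 T).
exact: opnormZ_le.
Qed.

Lemma opnorm0_eq0 T : opnorm T = 0 -> T = 0.
Proof.
move=> T0; apply/val_inj/funext => x; apply/eqP.
by have := opnormP T x; rewrite T0 mul0r normr_le0.
Qed.

HB.instance Definition _ :=
  Lmodule_isNormed.Build K bounded_operator ler_opnormD opnormZ opnorm0_eq0.

End type.
Arguments bounded_linear X Y : clear implicits.

Lemma bounded_linear_comp (X Y Z : normedModType K)
    (T : bounded_operator Y Z) (S : bounded_operator X Y) :
  T \o S \in bounded_linear X Z.
Proof.
apply/asboolP; split => [a x y|x] /=; first by rewrite !linearP.
by apply: continuous_comp; exact: operator_continuous.
Qed.

Definition comp_operator (X Y Z : normedModType K)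
    (T : bounded_operator Y Z) (S : bounded_operator X Y) :
  bounded_operator X Z := BoundedOperator (bounded_linear_comp T S).

Definition endo (X : normedModType K) := bounded_operator X X.

Definition dual (X : normedModType K) := bounded_operator X K^o.

Lemma adjoint_bounded_linear (X : normedModType K) (T : endo X) :
  (fun y : dual X => comp_operator y T) \in bounded_linear (dual X) (dual X).
Proof.
pose f (y : dual X) : dual X := comp_operator y T.
have lf : linear f by move=> a x y; apply/val_inj/funext.
pose g : {linear dual X -> dual X} := HB.pack f (GRing.isLinear.Build _ _ _ _ _ lf).
have fT y : opnorm (f y) <= opnorm T * opnorm y.
  apply: opnorm_le => x x1.
  apply: (le_trans (opnormP y (T x))); rewrite mulrC.
  by apply: ler_wpM2r; [exact: opnorm_ge0|exact: opnorm_ubound].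
apply/asboolP; split => //.
apply: (@bounded_linear_continuous K _ _ g); apply/linear_boundedP.
near=> M => y; apply: (le_trans (fT y)).
apply: ler_wpM2r; first exact: opnorm_ge0.
near: M; apply: nbhs_pinfty_ge; exact/ger0_real/opnorm_ge0.
Unshelve. all: by end_near. Qed.

Definition adjoint (X : normedModType K) (T : endo X) : endo (dual X) :=
  BoundedOperator (adjoint_bounded_linear T).

Section endo.
Variable X : normedModType K.

Definition compact_operator (T : endo X) : Prop :=
  precompact [set T x | x in [set x : X | `|x| <= 1]].

Definition essential_norm (T : endo X) : K :=
  infimum 0 [set `|T + C| | C in compact_operator].

Lemma essential_normE T :
  infimums [set `|T + C| | C in compact_operator] (essential_norm T).
Proof.
have c0 : compact_operator 0.
  apply: (@precompact_subset _ _ [set 0]); first by move=> _ [x _ <-].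
  by apply: compact_precompact; [exact: norm_hausdorff|exact: compact_set1].
have Tc : [set `|T + C| | C in compact_operator] `|T + 0| by exists 0.
rewrite /essential_norm /infimum; case: ifPn => [/eqP E0|_].
  by move: Tc; rewrite E0.
case: xgetP => [y -> //|E0].
have [||y /E0 //] := @infimums_scalars _ _
  [set `|T + C| | C in compact_operator]; first by exists `|T + 0|.
by move=> _ [C _ <-].
Qed.

Definition finite_rank (T : endo X) : Prop :=
  exists (n : nat) (v : 'I_n -> X),
    forall x, exists c : 'I_n -> K, T x = \sum_(i < n) c i *: v i.

Definition operator_algebra (A : set (endo X)) : Prop :=
  [/\ A 0,
      forall (a : K) S T, A S -> A T -> A (a *: S + T)
    & forall S T, A S -> A T -> A (comp_operator S T)].

End endo.

End bounded_operators.

(* Main.v *)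
(* Idea. For y in X^* let G_y be the closure of {T^* y : T in A, ||T||_e < 1}.

   If G_y is not all of X^* for some y <> 0, then, as in the Bishop-Phelps
   theorem, this closed convex set has a support point: some z in G_y and
   f <> 0 in X^** with sup Re f(G_y) = f(z).  As G_y is balanced and
   T^* G_y is contained in ||T||_e G_y, this gives |f(T^* z)| <= ||T||_e f(z);
   if z = 0, then f vanishes on A^* y and a multiple of f works together
   with y.

   If all these sets are X^*, fix y0 with ||y0|| = 2.  Every y in the
   weak-star compact ball S = B(y0, 1) is sent near y0 by the adjoint of some
   T = U + C in A with ||U|| <= 1/8 and C compact; C^* is weak-star to norm
   continuous on S, so the same T works near y.  A partition of unity and the
   Schauder-Tychonoff theorem then give a convex combination T of such
   operators and y in S with T^* y = y.  So 1 - t T is singular for some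
   smallest t in ]0, 1].  The resolvents T (1 - s T)^-1, s < t, stay in A;
   normalised, they accumulate in norm, as s tends to t, at a non-zero L in A
   with L = t T L.  The range of L lies in the kernel of 1 - t T, which is
   finite dimensional because ||T||_e < 1, contradicting the hypothesis. *)

Require Import Defs.
From mathcomp Require Import all_boot zify.

Set Implicit Arguments.
Unset Strict Implicit.
Unset Printing Implicit Defensive.

(** * Scarf's lemma *)

(** A fixed functional of the adjoint of [T], with [||T||_e < 1], would classically lead to a Riesz
    projection of finite rank. Real scalars allow no contour integrals, and [A] need not contain the
    identity, so one works with what Neumann series produce from [T] inside [A]. Hence the walk
    along the segment from 0 to 1: the first singular parameter is approached through resolvents in
    [A], which must blow up there, and normalising them makes the inhomogeneous term vanish in the
    limit. Norm convergence, needed for a limit that is non-zero and in [A], rests on the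
    compactness of [W |-> C W C]: commutation with [T] lets the compact part act on both sides. The
    ball around [y0] has radius 1 and [y0] has norm 2, which keeps 0 out of the ball. The fixed
    point theorem is proved in a power of the real line, hence the passage to real parts of
    functionals. It rests on Brouwer's theorem, and that on Scarf's lemma, a parity count which
    needs no triangulation. *)

Section Scarf.
Variables (P I : finType) (r : I -> P -> nat) (c : P -> I).
Hypothesis r_inj : forall i, injective (r i).
Implicit Types (Q : {set P}) (J : {set I}).

(** No point exceeds the minima of [Q] in all orders of [J] at once; this condition replaces the
    cells of a triangulation. *)
Definition dominant Q J :=
  [forall p, exists i in J, [forall q in Q, r i p <= r i q]].

Lemma dominantP Q J :
  reflect (forall p, exists2 i, i \in J & forall q, q \in Q -> r i p <= r i q)
          (dominant Q J).
Proof.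
apply: (iffP forallP) => [h p|h p].
  have /exists_inP[i iJ /forall_inP hi] := h p; by exists i.
by have [i iJ hi] := h p; apply/exists_inP; exists i => //; apply/forall_inP.
Qed.

Lemma dominantS Q Q' J J' :
  Q' \subset Q -> J \subset J' -> dominant Q J -> dominant Q' J'.
Proof.
move=> QQ JJ /dominantP h; apply/dominantP => p; have [i iJ hi] := h p.
by exists i => [|q qQ]; [exact: (subsetP JJ)|exact/hi/(subsetP QQ)].
Qed.

(** Rooms play the part of cells, and dominant pairs with one more index than points that of walls;
    [incident] enters a room by giving up an index or by taking a new point. *)
Definition room (X : {set P} * {set I}) := dominant X.1 X.2 && (#|X.1| == #|X.2|).

Definition incident (D X : {set P} * {set I}) :=
  (X.1 == D.1) && [exists j in D.2, X.2 == D.2 :\ j]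
  || (X.2 == D.2) && [exists p in ~: D.1, X.1 == p |: D.1].

Lemma incidentP (D X : {set P} * {set I}) : reflect
  ((exists2 j, j \in D.2 & X = (D.1, D.2 :\ j)) \/
   (exists2 p, p \notin D.1 & X = (p |: D.1, D.2)))
  (incident D X).
Proof.
case: X => A B; apply: (iffP orP) => /=.
  case=> /andP[/eqP -> /exists_inP[z zD /eqP ->]].
    by left; exists z.
  by right; exists z => //; rewrite inE in zD.
case=> [] [z zD [-> ->]]; rewrite !eqxx /=; [left|right]; apply/exists_inP;
  by exists z => //; rewrite inE.
Qed.

Section door.
Variables (Q : {set P}) (J : {set I}) (q0 : P).
Hypotheses (q0Q : q0 \in Q) (domQJ : dominant Q J) (cardQJ : #|J| = #|Q|.+1).

Let m i := [arg min_(q < q0 in Q) r i q].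

Let mQ i : m i \in Q.
Proof. by rewrite /m; case: arg_minnP. Qed.

Let m_le i q : q \in Q -> r i (m i) <= r i q.
Proof. by rewrite /m; case: arg_minnP => // j _ h qQ; apply: h. Qed.

Let m_eq i q : q \in Q -> (forall q', q' \in Q -> r i q <= r i q') -> m i = q.
Proof.
by move=> qQ h; apply/(@r_inj i)/eqP; rewrite eqn_leq m_le//= h.
Qed.

Let surj_m J' : dominant Q J' -> Q \subset m @: J'.
Proof.
move=> /dominantP h; apply/subsetP => q qQ; have [i iJ hi] := h q.
by apply/imsetP; exists i => //; rewrite (m_eq qQ hi).
Qed.

Let imm (J' : {set I}) : m @: J' \subset Q.
Proof. by apply/subsetP => _ /imsetP[i _ ->]. Qed.

Let good j := (j \in J) && (m @: (J :\ j) == Q).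

Let good_inj j : good j -> {in J :\ j &, injective m}.
Proof.
case/andP=> jJ /eqP e; apply/imset_injP; rewrite e.
by have := cardsD1 j J; rewrite jJ cardQJ add1n => -[->].
Qed.

(** Dominance makes [m] map [J] onto [Q] with one index too many, so exactly two indices share a
    minimum, and either of them may be dropped. *)
Let goodE : exists a b, [/\ a != b, good a, good b &
  forall j, good j -> j = a \/ j = b].
Proof.
have mJ : m @: J = Q by apply/eqP; rewrite eqEsubset imm surj_m.
have /dinjectivePn[a aJ [b /andP[/= ba bJ] mab]] : ~~ dinjectiveb m (mem J).
  apply/negP => /dinjectiveP inj; have /imset_injP : {in J &, injective m} by [].
  by rewrite mJ cardQJ ltn_eqF.
have drop x y : x \in J -> y \in J -> x != y -> m x = m y -> good x.
  move=> xJ yJ xy mxy; rewrite /good xJ eqEsubset imm /= -{1}mJ.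
  apply/subsetP => _ /imsetP[i iJ ->]; have [->|ix] := eqVneq i x.
    by rewrite mxy; apply: imset_f; rewrite !inE eq_sym xy.
  by apply: imset_f; rewrite !inE ix.
exists a, b; rewrite eq_sym; split => //.
- by apply: (drop a b) => //; rewrite eq_sym.
- by apply: (drop b a).
- move=> j gj; have [->|ja] := eqVneq j a; first by left.
  have [->|jb] := eqVneq j b; first by right.
  have := good_inj gj (x := a) (y := b).
  rewrite !inE eq_sym ja aJ [b == j]eq_sym jb bJ => /(_ isT isT mab) ab.
  by rewrite ab eqxx in ba.
Qed.

Let M j := [set p | [forall i in J :\ j, r i (m i) < r i p]].

Let MP j p : reflect (forall i, i \in J :\ j -> r i (m i) < r i p) (p \in M j).
Proof. by rewrite inE; apply: (iffP forall_inP). Qed.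

Let exit j := if [pick p in M j] is Some p1 then
    ([arg max_(p > p1 in M j) r j p] |: Q, J)
  else (Q, J :\ j).

Let M_notin j p : good j -> p \in M j -> p \notin Q.
Proof.
move=> /andP[jJ /eqP e] pM; apply/negP; rewrite -e => /imsetP[i iJ pE].
by have /MP/(_ i iJ) := pM; rewrite pE ltnn.
Qed.

Let exit_spec j : good j ->
  room (exit j) /\ ((M j = set0 /\ exit j = (Q, J :\ j)) \/
  exists p, [/\ p \in M j, (forall p', p' \in M j -> r j p' <= r j p) &
     exit j = (p |: Q, J)]).
Proof.
move=> gj; have /andP[jJ _] := gj; rewrite /exit; case: pickP => [p1 p1M|M0].
  case: arg_maxnP => // p pM pmax; split; last by right; exists p.
  have pQ := M_notin gj pM.
  rewrite /room /= cardsU1 pQ cardQJ eqxx andbT; apply/dominantP => p'.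
  have pj q : q \in Q -> r j p < r j q.
    move=> qQ; have /dominantP/(_ p)[i iJ hi] := domQJ.
    have [eij|ij] := eqVneq i j.
      rewrite -eij ltn_neqAle hi// andbT; apply/eqP => /r_inj pq.
      by rewrite pq qQ in pQ.
    have /MP/(_ i) := pM; rewrite !inE ij iJ => /(_ isT).
    by rewrite ltnNge hi.
  have [p'M|] := boolP (p' \in M j).
    exists j => // q; rewrite !inE => /orP[/eqP ->|qQ]; first exact: pmax.
    by apply: leq_trans (pmax _ p'M) _; apply/ltnW/pj.
  rewrite inE negb_forall_in => /exists_inP[i iJ]; rewrite -leqNgt => le.
  have iJ' : i \in J by move: iJ; rewrite inE => /andP[].
  exists i => // q; rewrite !inE => /orP[/eqP ->|qQ].
    by apply: leq_trans le (ltnW _); have /MP := pM; apply.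
  exact: leq_trans le (m_le _ qQ).
have M0' : M j = set0 by apply/setP => p; rewrite M0 inE.
split; last by left.
rewrite /room /=; have := cardsD1 j J; rewrite jJ cardQJ add1n => -[->].
rewrite eqxx andbT; apply/dominantP => p'.
have : p' \notin M j by rewrite M0' inE.
rewrite inE negb_forall_in => /exists_inP[i iJ]; rewrite -leqNgt => le.
by exists i => // q qQ; apply: leq_trans le (m_le _ qQ).
Qed.

Let exit_uniq X : room X -> incident (Q, J) X -> exists2 j, good j & X = exit j.
Proof.
move=> rX /incidentP /= []; last first.
  case=> p pQ XE; move: rX; rewrite {}XE => /andP[/= dp _].
  have /dominantP/(_ p)[j jJ hj] := dp.
  have key q : q \in Q -> exists2 i, i \in J :\ j & m i = q /\ r i q < r i p.
    move=> qQ; have /dominantP/(_ q)[i iJ hi] := dp.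
    have qp : q != p by apply: contraNneq pQ => <-.
    have lt : r i q < r i p.
      rewrite ltn_neqAle hi ?inE ?eqxx// andbT; apply: contraNneq qp.
      by move/r_inj ->.
    exists i; last first.
      by split => //; apply: m_eq => // q' q'Q; apply: hi; rewrite inE q'Q orbT.
    rewrite !inE iJ andbT; apply: contraTneq lt => ->.
    by rewrite -leqNgt hj// inE qQ orbT.
  have gj : good j.
    rewrite /good jJ eqEsubset imm /=; apply/subsetP => q /key[i iJ [<- _]].
    exact: imset_f.
  have pM : p \in M j.
    apply/MP => i iJ; have [i' i'J [mi' lt]] := key (m i) (mQ i).
    by rewrite (good_inj gj i'J iJ mi') in lt.
  have pmax p' : p' \in M j -> r j p' <= r j p.
    move=> p'M; have /dominantP/(_ p')[i iJ hi] := dp.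
    have [eij|ij] := eqVneq i j; first by subst i; apply: hi; rewrite !inE eqxx.
    have /MP/(_ i) := p'M; rewrite !inE ij iJ => /(_ isT).
    by rewrite ltnNge hi// inE mQ orbT.
  exists j => //; have [_ [[M0 _]|[p' [p'M p'max ->]]]] := exit_spec gj.
    by rewrite M0 inE in pM.
  congr (_ |: _, _); apply/(@r_inj j)/eqP.
  by rewrite eqn_leq pmax// p'max.
case=> j jJ XE; move: rX; rewrite {}XE => /andP[/= dX _].
have gj : good j by rewrite /good jJ eqEsubset imm surj_m.
exists j => //; have [_ [[_ ->//]|[p [pM _ _]]]] := exit_spec gj.
have /dominantP/(_ p)[i iJ hi] := dX.
by have /MP/(_ i iJ) := pM; rewrite ltnNge hi.
Qed.

(** The two rooms are the exits at the two good indices. They differ because a point common to [M a]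
    and [M b] would exceed the minima of [Q] in all orders of [J]. *)
Lemma card_rooms_door : #|[set X | room X && incident (Q, J) X]| = 2.
Proof.
have [a [b [ab ga gb gab]]] := goodE.
have /andP[aJ _] := ga; have /andP[bJ _] := gb.
have cD j : j \in J -> J :\ j != J.
  by move=> jJ; apply/eqP => /setP/(_ j); rewrite setD11 jJ.
have neq : exit a != exit b.
  have [_ [[_ ->]|[p [pM pm ->]]]] := exit_spec ga;
    have [_ [[_ ->]|[p' [p'M pm' ->]]]] := exit_spec gb; apply/eqP => -[].
  - move=> /setP/(_ a); rewrite !inE eqxx /= aJ andbT.
    by rewrite (negbTE ab).
  - by move=> _ /eqP; apply/negP/cD.
  - by move=> _ /esym/eqP; apply/negP/cD.
  - move=> /setP/(_ p); rewrite !inE eqxx /= => /esym/orP[/eqP pp|pQ]; last first.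
      by have := M_notin ga pM; rewrite pQ.
    subst p'; have /dominantP/(_ p)[i iJ hi] := domQJ.
    have [eia|ia] := eqVneq i a.
      have /MP/(_ i) := p'M; rewrite !inE iJ {1}eia ab => /(_ isT).
      by rewrite ltnNge hi.
    have /MP/(_ i) := pM; rewrite !inE ia iJ => /(_ isT).
    by rewrite ltnNge hi.
have exit_in j : good j -> room (exit j) /\ incident (Q, J) (exit j).
  move=> gj; have [rj h] := exit_spec gj; split => //; apply/incidentP => /=.
  have /andP[jJ _] := gj.
  case: h => [[_ ->]|[p [pM _ ->]]]; [left; by exists j|right].
  by exists p => //; exact: M_notin pM.
have -> : [set X | room X && incident (Q, J) X] = [set exit a; exit b].
  apply/setP => X; rewrite !inE; apply/andP/orP.
    move=> [rX /(exit_uniq rX)[j /gab[]-> ->]]; by [left|right].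
  by case=> /eqP ->; exact: exit_in.
by rewrite cards2 neq.
Qed.
End door.

Section parity.
Variables (p0 : P) (i0 : I).

Let door (D : {set P} * {set I}) := [&& dominant D.1 D.2, i0 \in D.2,
  c @: D.1 == D.2 :\ i0 & #|D.1|.+1 == #|D.2|].

Let card_rooms_start : #|[set X | room X && incident (set0, [set i0]) X]| = 1.
Proof.
pose p := [arg max_(p > p0) r i0 p].
have pmax p' : r i0 p' <= r i0 p by rewrite /p; case: arg_maxnP => // q _; apply.
have -> : [set X | room X && incident (set0, [set i0]) X] =
    [set ([set p], [set i0])].
  apply/setP => X; rewrite !inE; apply/andP/eqP => [|->]; last first.
    split; last by apply/incidentP; right; exists p; rewrite ?inE ?setU0.
    rewrite /room /= !cards1 eqxx andbT; apply/dominantP => p'.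
    by exists i0 => [|q]; rewrite !inE // => /eqP ->.
  case=> + /incidentP[[j /set1P -> XE]|[q _ XE]]; rewrite {X}XE /=.
    by rewrite setDv => /andP[/dominantP/(_ p0)[i]]; rewrite inE.
  rewrite setU0 => /andP[/dominantP/(_ p)[i /set1P ->]] /(_ q); rewrite inE eqxx.
  move=> /(_ isT) le _; congr ([set _], _); apply/(@r_inj i0)/eqP.
  by rewrite eqn_leq le pmax.
by rewrite cards1.
Qed.

Let card_rooms D : door D ->
  #|[set X | room X && incident D X]| = if D == (set0, [set i0]) then 1 else 2.
Proof.
case: D => Q J /and4P[/= dQJ iJ cQ /eqP cardQJ].
case: ifPn => [/eqP[-> ->]//|neq].
have [Q0|[q0 q0Q]] := set_0Vmem Q; last by apply: (card_rooms_door q0Q).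
case/negP: neq; rewrite Q0; apply/eqP; congr pair; apply/esym/eqP.
by rewrite eqEcard sub1set iJ cards1 -cardQJ Q0 cards0.
Qed.

(** A room with a door has a point [q] whose removal leaves the colours [J :\ i0]. Either the colour
    of [q] occurs a second time, and each of the two points may go, or it lies outside [J], and
    adding it to [J] is the alternative to removing [q]. *)
Let card_doors X : room X -> c @: X.1 != X.2 ->
  ~~ odd #|[set D | door D && incident D X]|.
Proof.
case: X => Q J /andP[/= dQJ /eqP cardQJ] cQJ.
set E := [set D | _].
have [->|[D DE]] := set_0Vmem E; first by rewrite cards0.
have inE1 q : q \in Q -> i0 \in J -> c @: (Q :\ q) = J :\ i0 ->
    (Q :\ q, J) \in E.
  move=> qQ iJ e; rewrite inE; apply/andP; split; last first.
    by apply/incidentP; right; exists q; rewrite /= ?setD1K// !inE eqxx.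
  rewrite /door /= iJ e eqxx (dominantS _ _ dQJ) ?subsetDl//=.
  by rewrite -cardQJ (cardsD1 q Q) qQ.
have inE2 j : j \notin J -> i0 \in J -> c @: Q = (j |: J) :\ i0 ->
    (Q, j |: J) \in E.
  move=> jJ iJ e; rewrite inE; apply/andP; split; last first.
    by apply/incidentP; left; exists j; rewrite /= ?setU1K// !inE eqxx.
  rewrite /door /= e eqxx !inE iJ orbT (dominantS _ _ dQJ) ?subsetUr//=.
  by rewrite cardQJ cardsU1 jJ.
have E_inv D' : D' \in E ->
    (exists q, [/\ q \in Q, i0 \in J, c @: (Q :\ q) = J :\ i0 & D' = (Q :\ q, J)])
    \/ (exists j, [/\ j \notin J, i0 \in J, c @: Q = (j |: J) :\ i0
         & D' = (Q, j |: J)]).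
  rewrite inE => /andP[/and4P[_ iD /eqP cD _]].
  case: D' iD cD => Q' J' /= iD cD /incidentP[[j /= jJ' [QE JE]]|[p /= pQ [QE JE]]];
    subst.
    have JE' : J' = j |: (J' :\ j) by rewrite setD1K.
    right; exists j; rewrite -JE' !inE eqxx iD andbT cD; split => //.
    apply/eqP => ji; by rewrite cD ji eqxx in cQJ.
  left; exists p; rewrite !inE eqxx /= setU1K//; by split.
(* If the known door adds an index [j], removing the point of colour [j] gives a door as well. *)
have [q [qQ iJ cq]] :
    exists q, [/\ q \in Q, i0 \in J & c @: (Q :\ q) = J :\ i0].
  have [[q [qQ iJ e _]]|[j [jJ iJ e _]]] := E_inv _ DE; first by exists q.
  have ji : j != i0 by apply: contraNneq jJ => ->.
  have inj : {in Q &, injective c}.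
    apply/imset_injP; rewrite e cardQJ.
    by have := cardsD1 i0 (j |: J); rewrite !inE iJ orbT cardsU1 jJ !add1n => -[->].
  have : j \in c @: Q by rewrite e !inE eqxx ji.
  case/imsetP => q qQ jE; exists q; split => //; apply/setP => i.
  apply/imsetP/idP => [[q']|iJ'].
    rewrite !inE => /andP[q'q q'Q] ->.
    have : c q' \in c @: Q by apply: imset_f.
    rewrite e !inE => /andP[-> /= /orP[/eqP cj|//]].
    by rewrite (inj _ _ q'Q qQ) ?eqxx// -?jE in q'q; rewrite cj.
  have : i \in c @: Q by rewrite e; move: iJ'; rewrite !inE => /andP[-> ->]; rewrite orbT.
  case/imsetP => q' q'Q iE; exists q' => //; rewrite !inE q'Q andbT.
  apply: contraNneq jJ => q'q; move: iJ'; rewrite !inE iE q'q -jE.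
  by case/andP.
have injq : {in Q :\ q &, injective c}.
  apply/imset_injP; rewrite cq.
  by have := cardsD1 i0 J; rewrite iJ -cardQJ (cardsD1 q Q) qQ !add1n => -[->].
have cardq : #|Q :\ q|.+1 = #|J| by rewrite -cardQJ (cardsD1 q Q) qQ.
have cardi : #|J :\ i0|.+1 = #|J| by rewrite (cardsD1 i0 J) iJ.
have cqi : c q != i0.
  apply: contraNneq cQJ => ci; rewrite -[Q](setD1K qQ) imsetU1 cq ci.
  by rewrite setD1K.
have [cqJ|cqJ] := boolP (c q \in J).
  have : c q \in c @: (Q :\ q) by rewrite cq !inE cqi.
  case/imsetP => q'; rewrite !inE => /andP[q'q q'Q] cqq'.
  have cQE : c @: Q = J :\ i0.
    by rewrite -[Q](setD1K qQ) imsetU1 cq; apply/setUidPr; rewrite sub1set !inE cqi.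
  have cq'E : c @: (Q :\ q') = J :\ i0.
    rewrite -cQE; apply/setP => i; apply/imsetP/imsetP => -[x].
      by rewrite !inE => /andP[_ xQ] ->; exists x.
    move=> xQ ->; have [->|xq'] := eqVneq x q'; last by exists x; rewrite // !inE xq'.
    by exists q; rewrite ?cqq'// !inE eq_sym q'q.
  suff -> : E = [set (Q :\ q, J); (Q :\ q', J)].
    rewrite cards2; case: eqP => //= -[] /setP/(_ q).
    by rewrite !inE eqxx qQ /= andbT eq_sym q'q.
  apply/setP => D'; apply/idP/set2P => [/E_inv[]|[] ->]; last 2 first.
  - exact: inE1.
  - exact: inE1.
  - case=> q'' [q''Q _ e ->]; have [->|q''q] := eqVneq q'' q; first by left.
    have [->|q''q'] := eqVneq q'' q'; first by right.
    exfalso; have /imset_injP inj : #|c @: (Q :\ q'')| == #|Q :\ q''|.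
      by rewrite e -eqSS cardi -cardQJ (cardsD1 q'' Q) q''Q.
    have := inj q q'; rewrite !inE eq_sym q''q qQ [q' == _]eq_sym q''q' q'Q.
    by move=> /(_ isT isT cqq') qq'; rewrite qq' eqxx in q'q.
  - case=> j [jJ _ e _]; exfalso; have : j \in c @: Q.
      by rewrite e !inE eqxx andbT; apply: contraNneq jJ => ->.
    by rewrite cQE !inE (negbTE jJ) andbF.
suff -> : E = [set (Q :\ q, J); (Q, c q |: J)].
  by rewrite cards2; case: eqP => //= -[] /setP/(_ q); rewrite !inE eqxx qQ.
have cQE : c @: Q = (c q |: J) :\ i0.
  rewrite -{1}[Q](setD1K qQ) imsetU1 cq; apply/setP => i; rewrite !inE.
  by have [->|//] := eqVneq i (c q); rewrite cqi.
apply/setP => D'; apply/idP/set2P => [/E_inv[]|[] ->]; last 2 first.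
- exact: inE1.
- exact: inE2.
- case=> q'' [q''Q _ e ->]; have [->|q''q] := eqVneq q'' q; first by left.
  exfalso; case/negP: cqJ; have : c q \in c @: (Q :\ q'').
    by apply: imset_f; rewrite !inE eq_sym q''q.
  by rewrite e !inE => /andP[].
- case=> j [jJ _ e ->]; right; congr (_, _ |: _).
  have : c q \in c @: Q by apply: imset_f.
  rewrite e !inE => /andP[_ /orP[/eqP //|]]; by rewrite (negbTE cqJ).
Qed.

(* Double counting of incident pairs: a door lies in two rooms, except the
   start (set0, [set i0]), which lies in one, and a room (Q, J) with
   c @: Q != J has an even number of doors. *)
Lemma scarf : exists Q J, dominant Q J /\ c @: Q = J.
Proof.
have [/existsP[[Q J] /andP[/andP[/= d _] /eqP e]]|none] :=
  boolP [exists X : {set P} * {set I}, room X && (c @: X.1 == X.2)].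
  by exists Q, J.
exfalso; pose N := \sum_(D | door D) \sum_(X | room X) (if incident D X then 1 else 0).
have evenN : ~~ odd N.
  rewrite /N exchange_big /=; elim/big_ind: _ => // [x y|X rX].
    by rewrite oddD => /negbTE -> /negbTE ->.
  rewrite -big_mkcondr /= sum1dep_card; apply: card_doors => //.
  by apply: contra none => e; apply/existsP; exists X; rewrite rX.
have : odd N.
  rewrite /N (bigD1 (set0, [set i0])) /=; last first.
    rewrite /door /= imset0 inE eqxx setDv eqxx cards0 cards1 !andbT.
    apply/dominantP => p; exists i0 => [|q]; by rewrite inE.
  rewrite oddD -big_mkcondr /= sum1dep_card card_rooms_start /=.
  elim/big_ind: _ => // [x y|D /andP[dD neq]].
    by rewrite oddD => /negbTE -> /negbTE ->.
  by rewrite -big_mkcondr /= sum1dep_card card_rooms// (negbTE neq).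
by rewrite (negbTE evenN).
Qed.
End parity.
End Scarf.

(** * Scarf's lemma on the integer points of a simplex *)

Section grid.
Variables (n k : nat).
Local Notation T := {ffun 'I_n.+1 -> 'I_k.+1}.
Local Notation grid := {a : T | \sum_i (a i : nat) == k}.
Variable c : T -> 'I_n.+1.

(** Ties in the [i]-th coordinate are broken by the rank, which is below [#|{: grid}|], so that
    division gives the coordinate back. *)
Let r (i : 'I_n.+1) (a : grid) := (val a i * #|{: grid}| + enum_rank a)%N.

Let r_inj i : injective (r i).
Proof.
move=> a b /(congr1 (modn^~ #|{: grid}|)); rewrite !modnMDl !modn_small//.
by move/val_inj/enum_rank_inj.
Qed.

Let r_le i a b : r i a <= r i b -> val a i <= val b i.
Proof.
move=> /(leq_div2r #|{: grid}|); have N0 : 0 < #|{: grid}|.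
  by apply/card_gt0P; exists a.
by rewrite !divnMDl// !divn_small// !addn0.
Qed.

Lemma mk_gridP (f : 'I_n.+1 -> nat) : \sum_i f i = k ->
  exists a : grid, forall i, val a i = f i :> nat.
Proof.
move=> fk; have lt i : f i < k.+1.
  by rewrite ltnS -fk (bigD1 i)//= leq_addr.
have h : \sum_i ([ffun i => Ordinal (lt i)] i : nat) == k.
  by apply/eqP; rewrite -[RHS]fk; apply: eq_bigr => i _; rewrite ffunE.
by exists (exist (fun a : T => \sum_i (a i : nat) == k) _ h) => i /=; rewrite ffunE.
Qed.

Lemma grid_scarf : exists q0 : T, \sum_i (q0 i : nat) = k /\
  forall i, exists q : T, [/\ \sum_i (q i : nat) = k,
    forall j, q j <= q0 j + n.+1 /\ q0 j <= q j + n.+1 &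
    c q = i \/ q i <= n.+1].
Proof.
have [|p0 _] := @mk_gridP (fun i => if i == ord0 then k else 0).
  by rewrite -big_mkcond /= big_pred1_eq.
have [Q [J [/dominantP domQ cQ]]] := scarf (c \o val) r_inj p0 ord0.
have [j0 j0J _] := domQ p0.
have [q0 q0Q _] : exists2 q, q \in Q & j0 = c (val q) by apply/imsetP; rewrite cQ.
pose m i := val (val [arg min_(q < q0 in Q) val (val q i)] i).
have m_le i q : q \in Q -> m i <= val q i.
  by move=> qQ; rewrite /m; case: arg_minnP => // q' _; apply.
have m_in i : exists2 q, q \in Q & m i = val q i.
  by rewrite /m; case: arg_minnP => // q' q'Q _; exists q'.
(* Otherwise the point with coordinates [m i + 1] on [J], the remaining mass being put on [j0],
   would exceed the minima of [Q] in every order of [J]. *)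
have big : k < \sum_(i in J) m i + #|J|.
  rewrite ltnNge; apply/negP => le.
  have sumJ : \sum_(i in J) (m i).+1 <= k.
    by under eq_bigr do rewrite -addn1; rewrite big_split /= sum1_card.
  pose f i := if i \in J then (m i).+1 + (if i == j0 then k - \sum_(i in J) (m i).+1 else 0) else 0.
  have [p pE] : exists a : grid, forall i, val a i = f i :> nat.
    apply: mk_gridP; rewrite /f -big_mkcond /= big_split /=.
    rewrite [X in _ + X](_ : _ = k - \sum_(i in J) (m i).+1) ?subnKC//.
    rewrite -big_mkcondr /= (big_pred1 j0)// => i.
    by rewrite /= andbC; case: eqP => //= ->.
  have [i iJ hi] := domQ p; have [q qQ miq] := m_in i.
  have := r_le (hi q qQ); rewrite pE /f iJ -miq; lia.
have cardJ : #|J| <= n.+1 by have := max_card (mem J); rewrite card_ord.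
(* A point of [Q] has sum [k] and is at least [m] on [J], so [big] leaves it less than [#|J|] of
   mass beyond these minima. *)
have spread q i : q \in Q ->
    if i \in J then val q i < m i + #|J| else val q i < #|J|.
  move=> qQ; have /eqP sq := valP q.
  have sJ : \sum_(j in J) m j <= \sum_(j in J) (val q j : nat).
    by apply: leq_sum => j _; exact: m_le.
  case: ifPn => iJ; last first.
    have : val q i + \sum_(j in J) (val q j : nat) <= \sum_j (val q j : nat).
      rewrite [leqRHS](bigD1 i)//= leq_add2l [leqRHS](bigID (mem J)) /=.
      apply: leq_trans (leq_addr _ _); rewrite [leqRHS](eq_bigl (mem J))// => j.
      by case: eqP => //= ->; rewrite (negbTE iJ).
    rewrite sq; lia.
  have sJ' : \sum_(j in J | j != i) m j <= \sum_(j in J | j != i) (val q j : nat).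
    by apply: leq_sum => j _; exact: m_le.
  have : \sum_(j in J) (val q j : nat) <= \sum_j (val q j : nat).
    by rewrite [leqRHS](bigID (mem J)) /= leq_addr.
  rewrite sq.
  have e1 : \sum_(j in J) m j = m i + \sum_(j in J | j != i) m j.
    by rewrite (bigD1 i).
  have e2 : \sum_(j in J) (val q j : nat) =
      val q i + \sum_(j in J | j != i) (val q j : nat) by rewrite (bigD1 i).
  move: big sJ'; rewrite e1 e2 => + + le; move: le.
  move: (\sum_(j in J | j != i) m j) (\sum_(j in J | j != i) (val q j : nat)).
  by move: (nat_of_ord (val q i)) (m i) => a b x y; lia.
exists (val q0); split; first exact/eqP/(valP q0).
have close q j : q \in Q -> val q j <= val q0 j + n.+1 /\ val q0 j <= val q j + n.+1.
  move=> qQ; have := spread q j qQ; have := spread q0 j q0Q.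
  by have := m_le j q qQ; have := m_le j q0 q0Q; case: ifP => _; lia.
move=> i; have [|iJ] := boolP (i \in J).
  rewrite -cQ => /imsetP[q qQ iE]; exists (val q); split.
  - exact/eqP/(valP q).
  - by move=> j; exact: close.
  - by left.
exists (val q0); split; [exact/eqP/(valP q0)|by move=> j; exact: close|right].
by have := spread q0 i q0Q; rewrite (negbTE iJ); lia.
Qed.
End grid.


(* Loaded only now: classical_sets shadows the names of many finset lemmas. *)
From HB Require Import structures.
From mathcomp Require Import all_order all_algebra complex.
From mathcomp Require Import all_classical all_reals all_analysis.
From mathcomp Require Import ring lra.

Import Order.TTheory GRing.Theory Num.Theory.
Import numFieldNormedType.Exports.

Local Open Scope classical_set_scope.
Local Open Scope ring_scope.

(** * Fixed point theorems of Brouwer and Schauder-Tychonoff *)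

Lemma cvg_sum (K : numFieldType) (V : pseudoMetricNormedZmodType K) (T : Type)
    (I : eqType) (F : set_system T) {FF : Filter F} (s : seq I) (f : I -> T -> V)
    (l : I -> V) :
  (forall i, i \in s -> f i x @[x --> F] --> l i) ->
  \sum_(i <- s) f i x @[x --> F] --> \sum_(i <- s) l i.
Proof.
elim: s => [|i s IHs] fl.
  by rewrite big_nil; under eq_fun do rewrite big_nil; exact: cvg_cst.
rewrite big_cons; under eq_fun do rewrite big_cons; apply: cvgD.
  by apply: fl; rewrite mem_head.
by apply: IHs => j js; apply: fl; rewrite inE js orbT.
Qed.

(** * Brouwer's theorem on the standard simplex *)

Section brouwer.
Variables (R : realType) (n : nat).
Implicit Types x : 'rV[R]_n.+1.

Definition simplex : set 'rV[R]_n.+1 :=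
  [set x | (forall i, 0 <= x 0 i) /\ \sum_i x 0 i = 1].

Lemma simplex_le1 x i : simplex x -> x 0 i <= 1.
Proof.
by case=> x0 <-; rewrite (bigD1 i)//= lerDl; apply: sumr_ge0.
Qed.

Lemma compact_simplex : compact simplex.
Proof.
apply: (@subclosed_compact _ _ [set x : 'rV[R]_n.+1 | forall i, `[0, 1]%classic (x ord0 i)]).
- rewrite (_ : simplex = (\bigcap_(i in setT) [set x : 'rV[R]_n.+1 | 0 <= x 0 i]) `&`
    [set x : 'rV[R]_n.+1 | \sum_i x 0 i = 1]); last first.
    by apply/seteqP; split => x [x0 x1]; split=> // i; [move=> _|]; exact: x0.
  apply: closedI.
    apply: closed_bigI => i _.
    apply: (@closed_comp _ _ (fun x : 'rV[R]_n.+1 => x 0 i) [set t | 0 <= t]).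
      by move=> x _; exact: coord_continuous.
    exact: closed_ge.
  apply: (@closed_comp _ _ (fun x : 'rV[R]_n.+1 => \sum_i x 0 i) [set t | t = 1]).
    by move=> x _; apply: (@cvg_sum _ _ _ _ (nbhs x)) => i _; exact: coord_continuous.
  exact: closed_eq.
- exact: (@rV_compact R n.+1 (fun=> `[0, 1]%classic) (fun=> @segment_compact R 0 1)).
- by move=> x sx i /=; rewrite in_itv /= simplex_le1// andbT; case: sx.
Qed.

(** A grid point is coloured by a coordinate of largest increase under [g]; this increase is not
    negative, since the coordinates sum to 1 before and after. If [grid_scarf] offers a small
    coordinate instead of the colour [i], the claim follows from [0 <= g x' 0 i]. *)
Lemma approx_brouwer (g : 'rV[R]_n.+1 -> 'rV[R]_n.+1) :
  (forall x, simplex x -> simplex (g x)) ->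
  forall k : nat, exists x, simplex x /\ forall i, exists x', [/\ simplex x',
    forall j, `|x 0 j - x' 0 j| <= n.+1%:R / k.+1%:R &
    x' 0 i - n.+1%:R / k.+1%:R <= g x' 0 i].
Proof.
move=> gS k.
pose pt (a : {ffun 'I_n.+1 -> 'I_k.+2}) : 'rV[R]_n.+1 :=
  \row_i ((a i : nat)%:R / k.+1%:R).
have ptS (a : {ffun 'I_n.+1 -> 'I_k.+2}) : (\sum_i (a i : nat) = k.+1)%N -> simplex (pt a).
  move=> ak; split => [i|]; first by rewrite mxE divr_ge0.
  under eq_bigr do rewrite mxE.
  by rewrite -mulr_suml -natr_sum ak divff ?pnatr_eq0.
pose c a := [arg max_(i > ord0) (g (pt a) 0 i - pt a 0 i)]%O.
have cP (a : {ffun 'I_n.+1 -> 'I_k.+2}) : (\sum_i (a i : nat) = k.+1)%N ->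
    pt a 0 (c a) <= g (pt a) 0 (c a).
  move=> ak; rewrite -subr_ge0 leNgt; apply/negP => lt0.
  have [_ sg] := gS _ (ptS _ ak); have [_ sp] := ptS _ ak.
  have : \sum_i (g (pt a) 0 i - pt a 0 i) = 0 by rewrite sumrB sg sp subrr.
  have neg i : g (pt a) 0 i - pt a 0 i < 0.
    apply: le_lt_trans lt0; rewrite /c; case: arg_maxP => // j _; exact.
  rewrite big_ord_recl; have := neg ord0.
  have : \sum_(i < n) (g (pt a) 0 (lift ord0 i) - pt a 0 (lift ord0 i)) <= 0.
    by apply: sumr_le0 => i _; apply: ltW.
  lra.
have [q0 [q0k h]] := grid_scarf c.
exists (pt q0); split; first exact: ptS.
move=> i; have [q [qk close col]] := h i.
have nk : 0 <= n.+1%:R / k.+1%:R :> R by rewrite divr_ge0.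
exists (pt q); split; first exact: ptS.
  move=> j; rewrite !mxE -mulrBl normrM [X in _ * X]ger0_norm// ler_pM2r//.
  have [h1 h2] := close j; rewrite -!(ler_nat R) !natrD in h1 h2.
  by rewrite ler_norml; apply/andP; split; lra.
case: col => [<-|small]; first by rewrite lerBlDr (le_trans (cP q qk))// lerDl.
have [+ _] := gS _ (ptS _ qk) => /(_ i); apply: le_trans.
by rewrite subr_le0 mxE ler_pM2r// ler_nat.
Qed.

(** At a cluster point of the approximations [g] decreases no coordinate, and the equal sums force
    equality. Continuity is asked within the simplex because [approx_fixed] controls its map only
    there. *)
Lemma brouwer_simplex (g : 'rV[R]_n.+1 -> 'rV[R]_n.+1) :
  (forall x i, simplex x ->
    g y 0 i @[y --> within simplex (nbhs x)] --> g x 0 i) ->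
  (forall x, simplex x -> simplex (g x)) -> exists2 x, simplex x & g x = x.
Proof.
move=> gc gS; have /choice[u uP] := approx_brouwer gS.
have [|x [Sx clx]] := @compact_simplex (u @ \oo) _.
  by exists 0%N => // k _ /=; have [] := uP k.
have step i : x 0 i <= g x 0 i.
  rewrite leNgt; apply/negP => lt; pose e := (x 0 i - g x 0 i) / 4.
  have e0 : 0 < e by rewrite /e; lra.
  have /cvg_ballP/(_ e e0)/nbhs_ballP[d /= d0 hd] := gc x i Sx.
  pose d' := Num.min d e; have d'0 : 0 < d' / 2 by rewrite divr_gt0// lt_min d0.
  have d'd : d' <= d by rewrite ge_min lexx.
  have d'e : d' <= e by rewrite ge_min lexx orbT.
  have [N _ hN] : \forall k \near \oo, n.+1%:R / k.+1%:R < d' / 2 :> R.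
    have : n.+1%:R * k.+1%:R^-1 @[k --> \oo] --> (n.+1%:R * 0 : R).
      by apply: cvgMr; exact: cvg_harmonic.
    rewrite mulr0 => /cvgrPdist_lt/(_ _ d'0); apply: filterS => k.
    by rewrite sub0r normrN ger0_norm// mulr_ge0.
  have [|y [[k kN <-] /= xk]] := clx (u @` [set k | N <= k]%N) (ball x (d' / 2)) _
      (nbhsx_ballx _ _ d'0).
    by exists N => // k /= Nk; exists k.
  have [Su /(_ i)[x' [Sx' hx' gx']]] := uP k; have {}kN := hN k kN.
  move: (n.+1%:R / k.+1%:R) hx' gx' kN => t hx' gx' kN.
  have xx' : ball x d x'.
    split => // a j; rewrite [a]ord1; have [_ /(_ 0 j)] := xk; have := hx' j.
    rewrite /ball /= /ball_ => h1 h2.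
    apply: le_lt_trans (ler_distD (u k 0 j) _ _) _; apply: (lt_le_trans _ d'd).
    by rewrite [ltRHS]splitr ltrD// (le_lt_trans h1).
  have := hd _ xx' Sx'; have [_ /(_ 0 i)] := xx'.
  have [_ /(_ 0 i)] := xk; have := hx' i.
  rewrite /ball /= /ball_ !ltr_norml ler_norml => /andP[h1 h2] /andP[h3 h4] /andP[h5 h6].
  by move=> /andP[h7 h8]; move: d'e h7 h8; rewrite /e => *; lra.
exists x => //; apply/rowP => i; apply/eqP; rewrite eq_sym eq_le step /= leNgt; apply/negP => lt.
have [_ s1] := Sx; have [_ s2] := gS _ Sx.
have : \sum_j x 0 j < \sum_j g x 0 j by rewrite (bigD1 i)//= [ltRHS](bigD1 i)//= ltr_leD// ler_sum.
by rewrite s1 s2 ltxx.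
Qed.
End brouwer.

Lemma compact_finite_subcover (T : topologicalType) (A : set T) (U : T -> set T) :
  compact A -> (forall x, A x -> nbhs x (U x)) ->
  exists2 s : seq T, (forall x, x \in s -> A x) &
    forall x, A x -> exists2 y, y \in s & U y x.
Proof.
move=> cA nU; apply: contrapT => nos.
pose B (s : seq T) := [set x | A x /\ forall y, y \in s -> ~ U y x].
pose D := [set s : seq T | forall x, x \in s -> A x].
have FF : ProperFilter (filter_from D B).
  apply: filter_from_proper; last first.
    move=> s Ds; apply: contrapT => B0; apply: nos; exists s => // x Ax.
    apply: contrapT => noy; apply: B0; exists x; split => // y ys Uyx.
    by apply: noy; exists y.
  apply: filter_from_filter; first by exists [::].
  move=> s s' Ds Ds'; exists (s ++ s') => [x|x [Ax h]].
    by rewrite mem_cat => /orP[/Ds|/Ds'].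
  by split; split => // y ys; apply: h; rewrite mem_cat ys ?orbT.
have [|x [Ax /(_ (B [:: x]) (U x))]] := cA _ FF; first by exists [::] => // x [].
case; last by move=> y [[_ /(_ x (mem_head _ _))]].
  by exists [:: x] => // y; rewrite inE => /eqP ->.
exact: nU.
Qed.

Lemma cvg_ptws (U : Type) (V : topologicalType) (F : set_system {ptws U -> V})
    (f : {ptws U -> V}) : Filter F ->
  (forall t, g t @[g --> F] --> f t) -> F --> f.
Proof.
move=> FF Ff; apply/cvg_sup => t; apply/cvg_image.
  by rewrite eqEsubset; split => // v _; exists (cst v).
move=> W /Ff FW; exists ((fun g => g t) @^-1` W) => //.
by rewrite eqEsubset; split => [_ [g ? <-]//|v Wv]; exists (cst v).
Qed.

(** * The Schauder-Tychonoff theorem in a power of the real line *)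

Section schauder_tychonoff.
Variables (R : realType) (I : choiceType) (C : set {ptws I -> R}).
Variable Psi : {ptws I -> R} -> {ptws I -> R}.
Hypothesis C_compact : compact C.
Hypothesis C0 : C !=set0.
Hypothesis C_convex : forall n (l : 'rV[R]_n.+1) (z : 'I_n.+1 -> {ptws I -> R}),
  simplex l -> (forall i, C (z i)) -> C (fun v => \sum_i l 0 i * z i v).
Hypothesis PsiC : forall w, C w -> C (Psi w).
Hypothesis Psi_cont : forall w v, C w ->
  Psi w' v @[w' --> within C (nbhs w)] --> Psi w v.

Let eval_continuous (v : I) (w : {ptws I -> R}) : w' v @[w' --> w] --> w v.
Proof. by have /(_ w) := @proj_continuous I (fun=> R) v. Qed.

Let p (F : seq I) (w z : {ptws I -> R}) := \sum_(v <- F) `|w v - z v|.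

(** Schauder's projection read on the simplex: [l] is sent to the weights of [Psi (y l)] relative to
    a finite [d]-net. At a fixed [l] only net points [d]-close to [Psi (y l)] carry weight, so their
    mean [y l] is [d]-close too. *)
Let approx_fixed (F : seq I) (d : R) : 0 < d ->
  exists2 w, C w & forall v, v \in F -> `|Psi w v - w v| <= d.
Proof.
move=> d0.
have p_le w z v : v \in F -> `|w v - z v| <= p F w z.
  by move=> vF; rewrite /p (big_rem v)//= lerDl sumr_ge0.
have p_cvg T (G : set_system T) (f : T -> {ptws I -> R}) w z : Filter G ->
    (forall v, f t v @[t --> G] --> w v) -> p F (f t) z @[t --> G] --> p F w z.
  move=> FG h; apply: cvg_sum => v _; apply: cvg_norm; apply: cvgB => //.
  exact: cvg_cst.
have [s sC covD] : exists2 s : seq {ptws I -> R}, (forall z, z \in s -> C z) &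
    forall w, C w -> exists2 z, z \in s & p F w z < d.
  apply: (compact_finite_subcover C_compact (U := fun z => [set w | p F w z < d])).
  move=> z _; have := p_cvg _ (nbhs z) id z z (nbhs_filter z) (eval_continuous ^~ z).
  rewrite [X in _ --> X]big1 => [|v _]; last by rewrite subrr normr0.
  move=> /cvgrPdist_lt/(_ d d0); apply: filterS => w /=.
  by rewrite sub0r normrN ger0_norm// sumr_ge0.
have [w0 Cw0] := C0; have [z0 z0s _] := covD _ Cw0.
have [n sn] : exists n, size s = n.+1.
  by move: z0s; case: (s) => // a s' _; exists (size s').
pose z (i : 'I_n.+1) := nth w0 s i.
have zC i : C (z i).
  by apply: sC; rewrite mem_nth// sn.
have cov w : C w -> exists i, p F w (z i) < d.
  move=> /covD[y ys lt].
  have ltn : (index y s < n.+1)%N by rewrite -sn index_mem.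
  by exists (Ordinal ltn); rewrite /z nth_index.
(* Twice the positive part of [d - p F w (z i)]: the weights vanish where [z i]
   is not [d]-close, and are visibly continuous. *)
pose h i w := `|d - p F w (z i)| + (d - p F w (z i)).
have h0 i w : 0 <= h i w.
  by rewrite /h -lerBlDr sub0r -normrN ler_norm.
pose H w := \sum_i h i w.
have H0 w : C w -> 0 < H w.
  move=> /cov[i lt]; rewrite /H (bigD1 i)//= ltr_pwDl ?sumr_ge0//.
  by rewrite addr_gt0 ?normr_gt0 ?subr_gt0// subr_eq0 gt_eqF.
pose y (l : 'rV[R]_n.+1) : {ptws I -> R} := fun v => \sum_i l 0 i * z i v.
pose g l := \row_i (h i (Psi (y l)) / H (Psi (y l))).
have yC l : simplex l -> C (y l) by move=> /C_convex; apply.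
have [||l Sl gl] := @brouwer_simplex R n g.
- move=> l i Sl; have Cl := yC l Sl.
  set G := within _ _.
  have coord j : (l' : 'rV[R]_n.+1) 0 j @[l' --> G] --> l 0 j.
    by rewrite /G; apply: cvg_within_filter; exact: coord_continuous.
  have yl : y l' @[l' --> G] --> y l.
    apply: cvg_ptws => v; apply: cvg_sum => j _.
    by apply: cvgM; [exact: coord|exact: cvg_cst].
  have GS : G (@simplex R n) by exact: withinT.
  have ylC : y l' @[l' --> G] --> within C (nbhs (y l)).
    move=> P /yl hP; suff : G [set l' | P (y l')] by [].
    apply: filterS (@filterI _ G _ _ _ hP GS) => l' [/= + Sl']; apply.
    exact: yC.
  have hc j : h j (Psi (y l')) @[l' --> G] --> h j (Psi (y l)).
    have tc : d - p F (Psi (y l')) (z j) @[l' --> G] --> d - p F (Psi (y l)) (z j).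
      apply: cvgB; first exact: cvg_cst.
      apply: (p_cvg _ G (fun l' => Psi (y l'))) => v.
      apply: (cvg_comp y (fun w => Psi w v) ylC); exact: Psi_cont.
    by apply: cvgD => //; exact: cvg_norm.
  under eq_fun do rewrite mxE; rewrite mxE; apply: cvgM => //.
  apply: cvgV; first by rewrite gt_eqF// H0//; exact: PsiC.
  by apply: cvg_sum => j _.
- move=> l Sl; have Cw := PsiC (yC l Sl); split => [i|].
    by rewrite mxE divr_ge0// ltW// H0.
  under eq_bigr do rewrite mxE.
  by rewrite -mulr_suml divff// gt_eqF// H0.
exists (y l); first exact: yC.
move=> v vF; set w := Psi (y l); have Cw : C w by exact/PsiC/yC.
have [l0 l1] := Sl.
have -> : w v - y l v = \sum_i l 0 i * (w v - z i v).
  by under eq_bigr do rewrite mulrBr; rewrite sumrB -mulr_suml l1 mul1r.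
apply: le_trans (ler_norm_sum _ _ _) _.
rewrite -[leRHS]mul1r -l1 mulr_suml; apply: ler_sum => i _.
rewrite normrM ger0_norm//; have [lt|le] := ltP (p F w (z i)) d.
  by rewrite ler_wpM2l// (le_trans (p_le _ _ _ vF))// ltW.
rewrite (_ : l 0 i = 0) ?mul0r//.
by rewrite -gl mxE -/w /h ler0_norm ?subr_le0// addNr mul0r.
Qed.

Theorem schauder_tychonoff : exists2 w, C w & Psi w = w.
Proof.
pose A (Fd : seq I * R) :=
  [set w | C w /\ forall v, v \in Fd.1 -> `|Psi w v - w v| <= Fd.2].
pose D := [set Fd : seq I * R | 0 < Fd.2].
have FF : ProperFilter (filter_from D A).
  apply: filter_from_proper; last first.
    by move=> [F d] /= d0; have [w Cw hw] := approx_fixed F d0; exists w.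
  apply: filter_from_filter; first by exists ([::], 1); rewrite /D /=.
  move=> [F d] [F' d'] /= d0 d'0; exists (F ++ F', Num.min d d').
    by rewrite /D /= lt_min d0.
  move=> w /= [Cw hw]; split; split => // v vF.
    by apply: le_trans (hw _ _) _; rewrite ?mem_cat ?vF// ge_min lexx.
  by apply: le_trans (hw _ _) _; rewrite ?mem_cat ?vF ?orbT// ge_min lexx orbT.
have [|w [Cw clw]] := C_compact FF.
  by exists ([::], 1) => [|w []] //; rewrite /D /=.
exists w => //; apply/funext => v; apply/eqP; rewrite -subr_eq0 -normr_eq0.
rewrite eq_le normr_ge0 andbT leNgt; apply/negP => lt.
set e := `|_| in lt.
have cv : `|Psi w' v - w' v| @[w' --> within C (nbhs w)] --> e.
  apply: cvg_norm; apply: cvgB; first exact: Psi_cont.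
  by apply: cvg_within_filter; exact: eval_continuous.
have e2 : 0 < e / 2 by rewrite divr_gt0.
have /cvgrPdist_lt/(_ _ e2) hn := cv.
have [|w' [[Cw' /= hw'] /(_ Cw')]] := clw (A ([:: v], e / 2)) _ _ hn.
  by exists ([:: v], e / 2).
have := hw' v; rewrite mem_head => /(_ isT) le; rewrite ltr_norml => /andP[_].
lra.
Qed.
End schauder_tychonoff.

(** * Real and complex scalars *)

Section scalars.
Variable R : realType.

Definition of_real k : R -> scalars R k :=
  match k with RealScalars => id | ComplexScalars => fun a => a%:C%C end.

Definition real_part k : scalars R k -> R :=
  match k with RealScalars => id | ComplexScalars => @complex.Re R end.

Variable k : scalar_kind.
Local Notation K := (scalars R k).
Local Notation rc := (@of_real k).
Local Notation re := (@real_part k).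

Lemma rcD : {morph rc : a b / a + b}.
Proof. by rewrite /of_real; case: k => //= a b; rewrite rmorphD. Qed.

Lemma rcB : {morph rc : a b / a - b}.
Proof. by rewrite /of_real; case: k => //= a b; rewrite rmorphB. Qed.

Lemma rcN : {morph rc : a / - a}.
Proof. by rewrite /of_real; case: k => //= a; rewrite rmorphN. Qed.

Lemma rcM : {morph rc : a b / a * b}.
Proof. by rewrite /of_real; case: k => //= a b; rewrite rmorphM. Qed.

Lemma rc0 : rc 0 = 0.
Proof. by rewrite /of_real; case: k. Qed.

Lemma rc1 : rc 1 = 1.
Proof. by rewrite /of_real; case: k. Qed.

Lemma rcK : cancel rc re.
Proof. by rewrite /of_real /real_part; case: k. Qed.

Lemma rc_inj : injective rc. Proof. exact: can_inj rcK. Qed.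

Lemma rc_eq0 a : (rc a == 0) = (a == 0).
Proof. by rewrite -{1}rc0 (inj_eq rc_inj). Qed.

Lemma rcV a : rc a^-1 = (rc a)^-1.
Proof.
have [->|a0] := eqVneq a 0; first by rewrite invr0 rc0 invr0.
apply: (mulfI (x := rc a)); first by rewrite rc_eq0.
by rewrite -rcM !divff ?rc1// rc_eq0.
Qed.

Lemma ler_rc a b : (rc a <= rc b) = (a <= b).
Proof. by rewrite /of_real; case: k => //=; rewrite lecR. Qed.

Lemma ltr_rc a b : (rc a < rc b) = (a < b).
Proof. by rewrite !lt_def ler_rc (inj_eq rc_inj). Qed.

Lemma reD : {morph re : a b / a + b}.
Proof. by rewrite /real_part; case: k => //= -[? ?] [? ?]. Qed.

Lemma reN : {morph re : a / - a}.
Proof. by rewrite /real_part; case: k => //= -[? ?]. Qed.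

Lemma reB : {morph re : a b / a - b}.
Proof. by move=> a b; rewrite reD reN. Qed.

Lemma re0 : re 0 = 0. Proof. by rewrite -rc0 rcK. Qed.

Lemma re_rcM a z : re (rc a * z) = a * re z.
Proof. by rewrite /real_part /of_real; case: k z => //= -[u v] /=; rewrite mul0r subr0. Qed.

Lemma ge0_rc (z : K) : 0 <= z -> z = rc (re z).
Proof.
rewrite /real_part /of_real; case: k z => //= -[u v].
by rewrite lecE /= => /andP[/eqP -> _].
Qed.

Lemma le_re (a b : K) : a <= b -> re a <= re b.
Proof. by rewrite /real_part; case: k a b => //= -[? ?] [? ?]; rewrite lecE => /andP[]. Qed.

Lemma normr_rc a : `|rc a| = rc `|a|.
Proof.
rewrite /of_real; case: k => //=.
by rewrite normc_def /= expr0n addr0 sqrtr_sqr.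
Qed.

Lemma re_norm_ge (z : K) : `|re z| <= re `|z|.
Proof.
rewrite /real_part; case: k z => //= -[u v] /=.
by rewrite -sqrtr_sqr ler_wsqrtr// lerDl sqr_ge0.
Qed.

Lemma rotate (z : K) : exists2 u : K, `|u| = 1 & u * z = `|z|.
Proof.
have [->|z0] := eqVneq z 0; first by exists 1; rewrite ?normr1// mulr0 normr0.
exists (`|z| / z); last by rewrite divfK.
by rewrite normf_div normr_id divff// normr_eq0.
Qed.

Section norm.
Variable V : normedModType K.
Implicit Types x y : V.

(** Norms take values in [scalars R k]; their copy in [R] gives access to suprema, limits and linear
    arithmetic over the reals. *)
Definition rnorm x : R := re `|x|.

Lemma rnormE x : rc (rnorm x) = `|x|.
Proof. by rewrite /rnorm -ge0_rc. Qed.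

Lemma rnorm_ge0 x : 0 <= rnorm x.
Proof. by rewrite -ler_rc rnormE rc0. Qed.

Lemma rnorm0 : rnorm 0 = 0.
Proof. by rewrite /rnorm normr0 re0. Qed.

Lemma rnorm_eq0 x : (rnorm x == 0) = (x == 0).
Proof. by rewrite -rc_eq0 rnormE normr_eq0. Qed.

Lemma rnorm_gt0 x : (0 < rnorm x) = (x != 0).
Proof. by rewrite lt_def rnorm_ge0 andbT rnorm_eq0. Qed.

Lemma rnormD x y : rnorm (x + y) <= rnorm x + rnorm y.
Proof. by rewrite -ler_rc rcD !rnormE ler_normD. Qed.

Lemma rnormN x : rnorm (- x) = rnorm x.
Proof. by rewrite /rnorm normrN. Qed.

Lemma rdistC x y : rnorm (x - y) = rnorm (y - x).
Proof. by rewrite -rnormN opprB. Qed.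

Lemma rdistD z x y : rnorm (x - y) <= rnorm (x - z) + rnorm (z - y).
Proof. by apply: le_trans (rnormD _ _); rewrite addrA subrK. Qed.

Lemma rnormB x y : rnorm (x - y) <= rnorm x + rnorm y.
Proof. by rewrite -(rnormN y) rnormD. Qed.

Lemma rnormZ (a : K) x : rnorm (a *: x) = re `|a| * rnorm x.
Proof. by apply: rc_inj; rewrite rcM !rnormE -ge0_rc// normrZ. Qed.

Lemma rnormZr a x : rnorm (rc a *: x) = `|a| * rnorm x.
Proof. by rewrite rnormZ normr_rc rcK. Qed.

Lemma ler_norm_rc x (a : R) : (`|x| <= rc a) = (rnorm x <= a).
Proof. by rewrite -rnormE ler_rc. Qed.

Lemma cvg_rnormP (F : set_system V) x : Filter F ->
  (F --> x <-> forall e : R, 0 < e -> \forall y \near F, rnorm (x - y) < e).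
Proof.
move=> FF; split => [/cvgrPdist_lt h e e0|h].
  have := h (rc e); rewrite -rc0 ltr_rc => /(_ e0); apply: filterS => y.
  by rewrite -rnormE ltr_rc.
apply/cvgrPdist_lt => e e0; have eE := ge0_rc (ltW e0).
have : 0 < re e by rewrite -ltr_rc -eE rc0.
by move=> /h; apply: filterS => y; rewrite -ltr_rc -eE rnormE.
Qed.

(** Completeness as a property, to be proved for [endo X] and [dual X], which are only declared as
    normed spaces. *)
Definition banach := forall F : set_system V, ProperFilter F ->
  (forall e : R, 0 < e -> exists x, \forall y \near F, rnorm (x - y) < e) ->
  exists y, F --> y.
End norm.

Lemma banach_complete (V : completeNormedModType K) : banach V.
Proof.
move=> F FF h; have : cvg F; last by exists (lim F).
apply: cauchy_cvg; apply: cauchy_exP => e e0; have eE := ge0_rc (ltW e0).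
have : 0 < re e by rewrite -ltr_rc -eE rc0.
move=> /h[x hx]; exists x; apply: filterS hx => y.
by rewrite -ltr_rc -eE rnormE -ball_normE.
Qed.

End scalars.

Lemma banach_scalars (R : realType) k : banach ((scalars R k)^o).
Proof.
move=> F FF h.
have R_cvg (f : scalars R k -> R) :
    (forall x y, `|f x - f y| <= rnorm (x - y : (scalars R k)^o)) ->
    exists a : R, f y @[y --> F] --> a.
  move=> hf; have : cvg (f @ F); last by exists (lim (f @ F)).
  apply: cauchy_cvg; apply: cauchy_exP => e /h[x hx]; exists (f x).
  by apply: filterS hx => y; apply: le_lt_trans.
have [|a ha] := R_cvg (@real_part R k).
  by move=> x y; rewrite -reB re_norm_ge.
case: k F FF h R_cvg a ha => /= F FF h R_cvg a ha; first by exists a.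
have [|b hb] := R_cvg (@complex.Im R).
  move=> [x1 x2] [y1 y2]; rewrite /rnorm /= -sqrtr_sqr ler_wsqrtr//.
  by rewrite lerDr sqr_ge0.
exists (a +i* b)%C; apply/(@cvg_rnormP R ComplexScalars) => e e0.
have e2 : 0 < e / 2 by rewrite divr_gt0.
move: ha hb => /cvgrPdist_lt/(_ _ e2) ha /cvgrPdist_lt/(_ _ e2) hb.
apply: filterS (filterI ha hb) => -[y1 y2] /= [h1 h2].
rewrite /rnorm /=; apply: (@le_lt_trans _ _ (`|a - y1| + `|b - y2|)); last lra.
rewrite -[leRHS]ger0_norm ?addr_ge0// -sqrtr_sqr ler_wsqrtr//.
move: (a - y1) (b - y2) => p q; have := mulr_ge0 (normr_ge0 p) (normr_ge0 q).
by rewrite -(real_normK (num_real p)) -(real_normK (num_real q)); nra.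
Qed.

Section complexify.
Variables (R : realType) (k : scalar_kind) (V : lmodType (scalars R k)).
Local Notation K := (scalars R k).

Lemma complexify (phi : V -> R) :
  {morph phi : x y / x + y} -> (forall a x, phi (of_real k a *: x) = a * phi x) ->
  exists f : V -> K, (forall a x y, f (a *: x + y) = a * f x + f y) /\
    forall x, real_part (f x) = phi x.
Proof.
case: k V phi => /= W phi phiD phiZ.
  by exists phi; split => // a x y; rewrite phiD phiZ.
have phiN x : phi (- x) = - phi x.
  have := phiZ (-1) x; rewrite rmorphN rmorph1 scaleN1r => ->.
  by rewrite mulN1r.
(* The imaginary part of a complex functional at [x] is minus its real part at ['i *: x]. *)
pose f x := (phi x +i* - phi ('i *: x))%C.
exists f; split => // a x y.
have fD u v : f (u + v) = f u + f v.
  by rewrite /f; apply/eqP; rewrite eq_complex /= scalerDr !phiD opprD !eqxx.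
have fZ t u : f (t%:C%C *: u) = t%:C%C * f u.
  apply/eqP; rewrite eq_complex /= scalerA ['i * _]mulrC -scalerA !phiZ.
  by rewrite !mul0r subr0 addr0 mulrN !eqxx.
have fi u : f ('i *: u) = 'i * f u.
  apply/eqP; rewrite eq_complex /= scalerA -expr2 sqr_i scaleN1r phiN.
  by apply/andP; split; apply/eqP; ring.
rewrite fD; congr (_ + _); rewrite [a]complexE scalerDl fD fZ -scalerA fi fZ.
by rewrite mulrDl mulrA.
Qed.
End complexify.

(** * Bounded and compact operators *)

Section operators.
Variables (R : realType) (k : scalar_kind).
Local Notation K := (scalars R k).
Local Notation rc := (@of_real R k).
Local Notation re := (@real_part R k).
Implicit Types X Y Z : normedModType K.

Lemma op_eq X Y (S T : bounded_operator X Y) : S =1 T -> S = T.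
Proof. by move=> e; apply/val_inj/funext. Qed.

Lemma opD X Y (T : bounded_operator X Y) x y : T (x + y) = T x + T y.
Proof. exact: linearD. Qed.

Lemma opB X Y (T : bounded_operator X Y) x y : T (x - y) = T x - T y.
Proof. exact: linearB. Qed.

Lemma opZ X Y (T : bounded_operator X Y) a x : T (a *: x) = a *: T x.
Proof. exact: linearZ. Qed.

Lemma op_rnorm X Y (T : bounded_operator X Y) x : rnorm (T x) <= rnorm T * rnorm x.
Proof. by rewrite -(ler_rc k) rcM !rnormE; exact: opnormP. Qed.

Lemma op_rnorm_le X Y (T : bounded_operator X Y) (M : R) : 0 <= M ->
  (forall x, rnorm x <= 1 -> rnorm (T x) <= M) -> rnorm T <= M.
Proof.
move=> M0 h; rewrite -(ler_rc k) rnormE; apply: opnorm_le => x x1.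
by rewrite -rnormE ler_rc; apply: h; rewrite -(ler_rc k) rnormE rc1.
Qed.

Lemma op_rnorm_le1 X Y (T : bounded_operator X Y) x :
  rnorm x <= 1 -> rnorm (T x) <= rnorm T.
Proof.
move=> x1; apply: le_trans (op_rnorm _ _) _.
by rewrite -[leRHS]mulr1 ler_wpM2l// rnorm_ge0.
Qed.

Lemma comp_rnorm X Y Z (S : bounded_operator Y Z) (T : bounded_operator X Y) :
  rnorm (comp_operator S T) <= rnorm S * rnorm T.
Proof.
apply: op_rnorm_le => [|x x1]; first by rewrite mulr_ge0 ?rnorm_ge0.
apply: le_trans (op_rnorm S (T x)) _; rewrite ler_wpM2l ?rnorm_ge0//.
exact: op_rnorm_le1.
Qed.

Lemma mk_operator X Y (f : X -> Y) (M : R) :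
  (forall a x y, f (a *: x + y) = a *: f x + f y) ->
  (forall x, rnorm (f x) <= M * rnorm x) ->
  exists T : bounded_operator X Y, forall x, T x = f x.
Proof.
move=> lf bf.
pose g : {linear X -> Y} := HB.pack f (GRing.isLinear.Build _ _ _ _ f lf).
have cf : f \in @bounded_linear R k X Y.
  apply/asboolP; split => //.
  apply: (@bounded_linear_continuous K _ _ g); apply/linear_boundedP.
  exists (rc `|M|); split; first by rewrite -normr_rc normr_real.
  move=> a Ma x; apply: le_trans (_ : rc `|M| * `|x| <= _).
    rewrite -[X in _ <= _ * X]rnormE -rcM ler_norm_rc.
    by apply: le_trans (bf x) _; rewrite ler_wpM2r ?rnorm_ge0// ler_norm.
  by rewrite ler_wpM2r// ltW.
by exists (BoundedOperator cf).
Qed.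

Lemma cvg_op_eval X Y (F : set_system (bounded_operator X Y))
    (T : bounded_operator X Y) x : Filter F ->
  F --> T -> (fun S : bounded_operator X Y => S x) @ F --> T x.
Proof.
move=> FF /cvg_rnormP FT; apply/cvg_rnormP => e e0.
have d0 : 0 < rnorm x + 1 by rewrite ltr_wpDl ?rnorm_ge0.
have : 0 < e / (rnorm x + 1) by rewrite divr_gt0.
move=> /FT; apply: filterS => S; rewrite ltr_pdivlMr// => lt.
rewrite /= -[T x - S x]/((T - S) x); apply: le_lt_trans (op_rnorm _ _) _.
by apply: le_lt_trans lt; rewrite ler_wpM2l ?rnorm_ge0// lerDl.
Qed.

Lemma cvg_rnorm_le (V : normedModType K) (T : Type) (F : set_system T)
    (f : T -> V) (l : V) (M : R) : ProperFilter F -> f x @[x --> F] --> l ->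
  (\forall x \near F, rnorm (f x) <= M) -> rnorm l <= M.
Proof.
move=> FF /cvg_rnormP h hM; apply/ler_addgt0Pr => e /h he.
have [x [lt le]] := filter_ex (@filterI _ F _ _ _ he hM).
by have := rnormD (l - f x) (f x); rewrite subrK; move: lt le => /=; lra.
Qed.

Lemma banach_op X Y : banach Y -> banach (bounded_operator X Y).
Proof.
move=> bY F FF cF.
have cauchy x : exists y : Y, (fun T : bounded_operator X Y => T x) @ F --> y.
  apply: bY => e e0; have d0 : 0 < rnorm x + 1 by rewrite ltr_wpDl ?rnorm_ge0.
  have /cF[S hS] : 0 < e / (rnorm x + 1) by rewrite divr_gt0.
  exists (S x); apply: filterS hS => T; rewrite ltr_pdivlMr// => lt.
  rewrite /= -[S x - T x]/((S - T) x); apply: le_lt_trans (op_rnorm _ _) _.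
  by apply: le_lt_trans lt; rewrite ler_wpM2l ?rnorm_ge0// lerDl.
have [f hf] := choice cauchy.
have lf a x y : f (a *: x + y) = a *: f x + f y.
  have h : (fun T : bounded_operator X Y => T (a *: x + y)) @ F --> a *: f x + f y.
    have -> : (fun T : bounded_operator X Y => T (a *: x + y)) =
        (fun T => a *: T x + T y) by apply/funext => T; rewrite linearP.
    by apply: cvgD; [apply: cvgZr|].
  exact: (cvg_unique _ (hf _) h).
have close e : 0 < e -> exists S : bounded_operator X Y,
    (forall x, rnorm (f x - S x) <= e * rnorm x) /\ \forall T \near F, rnorm (S - T) < e.
  move=> /cF[S hS]; exists S; split => // x.
  rewrite -rnormN opprB; apply: (@cvg_rnorm_le _ _ F (fun T => S x - T x)).
    by apply: cvgB => //; exact: cvg_cst.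
  apply: filterS hS => T lt; rewrite /= -[S x - T x]/((S - T) x).
  by apply: le_trans (op_rnorm _ _) _; rewrite ler_wpM2r ?rnorm_ge0// ltW.
have [S1 [hS1 _]] := close 1 ltr01.
have [T hT] : exists T : bounded_operator X Y, forall x, T x = f x.
  apply: (@mk_operator _ _ _ (1 + rnorm S1)) => // x.
  have := rnormD (f x - S1 x) (S1 x); rewrite subrK => h; apply: le_trans h _.
  by rewrite mulrDl lerD// op_rnorm.
exists T; apply/cvg_rnormP => e e0.
have e2 : 0 < e / 2 by rewrite divr_gt0.
have [S [hS FS]] := close _ e2; apply: filterS FS => U lt.
apply: le_lt_trans (rdistD S _ _) _; rewrite [ltRHS]splitr.
apply: ler_ltD lt; apply: op_rnorm_le => [|x x1]; first exact: ltW.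
rewrite -[(T - S) x]/(T x - S x) hT; apply: le_trans (hS x) _.
by rewrite -[leRHS]mulr1 ler_wpM2l// ltW.
Qed.

End operators.

(** * Compact operators along ultrafilters *)

Section compact_operators.
Variables (R : realType) (k : scalar_kind).
Local Notation K := (scalars R k).
Local Notation rc := (@of_real R k).
Variable X : normedModType K.
Implicit Types S T C : endo X.

Lemma ultra_cvg_compact (I : Type) (U : set_system I) (f : I -> X) (A : set X) :
  UltraFilter U -> compact A -> (\forall i \near U, A (f i)) ->
  exists y : X, f @ U --> y.
Proof.
move=> UU cA fA; have [y [_ cly]] := cA (f @ U) _ fA.
exists y => B By; have [//|UB] := in_ultra_setVsetC (f @^-1` B) UU.
by have [z [? ?]] := cly (~` B) B UB By.
Qed.

Lemma compact_operator_ultra C (I : Type) (U : set_system I) (f : I -> X) (M : R) :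
  compact_operator C -> UltraFilter U ->
  (\forall i \near U, rnorm (f i) <= M) -> exists y : X, C (f i) @[i --> U] --> y.
Proof.
move=> cC UU fM; pose a := rc (`|M| + 1); have M0 : 0 < `|M| + 1 by rewrite ltr_wpDl.
have a0 : a != 0 by rewrite /a rc_eq0 gt_eqF.
have [||y hy] := @ultra_cvg_compact _ U (fun i => C (a^-1 *: f i))
  (closure [set C x | x in [set x : X | `|x| <= 1]]) UU.
- by move: cC; rewrite /compact_operator precompactE.
- apply: filterS fM => i fi; apply: subset_closure; exists (a^-1 *: f i) => //=.
  rewrite -rnormE -(rc1 R k) ler_rc /a -rcV rnormZr gtr0_norm ?invr_gt0//.
  by rewrite mulrC ler_pdivrMr// mul1r (le_trans fi)// (le_trans (ler_norm M))// lerDl.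
exists (a *: y); have -> : (fun i => C (f i)) = (fun i => a *: C (a^-1 *: f i)).
  by apply/funext => i; rewrite linearZ scalerA divff// scale1r.
exact: cvgZr.
Qed.

Lemma compact_operatorP C :
  (forall U : set_system X, UltraFilter U -> (\forall x \near U, rnorm x <= 1) ->
    exists y : X, C x @[x --> U] --> y) -> compact_operator C.
Proof.
move=> h; rewrite /compact_operator precompactE => F FF FA.
set A := [set C x | x in _] in FA *.
(* [F] lives on the closure of the image, whose points need not be values of [C]; it is pulled back
   to vectors whose image is merely [P.2]-close to [P.1]. *)
pose B (P : set X * R) :=
  [set x | rnorm x <= 1 /\ exists2 y, P.1 y & rnorm (C x - y) < P.2].
pose D := [set P : set X * R | F P.1 /\ 0 < P.2].
have GF : ProperFilter (filter_from D B).
  apply: filter_from_proper; last first.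
    move=> [P e] [/= FP e0]; have [y [Py cly]] := filter_ex (filterI FP FA).
    have rce0 : 0 < rc e by rewrite -(rc0 R k) ltr_rc.
    have [z [[x x1 <-] zy]] := cly _ (nbhsx_ballx y (rc e) rce0).
    exists x; split; first by rewrite -(ler_rc k) rnormE rc1.
    by exists y => //; rewrite rdistC -(ltr_rc k) rnormE; move: zy; rewrite -ball_normE.
  apply: filter_from_filter; first by exists (setT, 1); split => //; exact: filterT.
  move=> [P e] [P' e'] [/= FP e0] [/= FP' e'0].
  exists (P `&` P', Num.min e e'); first by split => /=; [exact: filterI|rewrite lt_min e0].
  move=> x [/= x1 [y [Py P'y]]]; rewrite lt_min => /andP[ye ye'].
  by split; split => //; exists y.
have [U [UU GU]] := ultraFilterLemma GF.
have [|l hl] := h U UU.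
  apply: GU; exists (setT, 1); first by split => //; exact: filterT.
  by move=> x [].
have {}hl e : 0 < e -> \forall x \near U, rnorm (l - C x) < e.
  by move/cvg_rnormP: hl; apply.
have near_l P e : F P -> 0 < e -> exists x y,
    [/\ rnorm x <= 1, P y, rnorm (C x - y) < e & rnorm (l - C x) < e].
  move=> FP e0; have UB : U (B (P, e)) by apply: GU; exists (P, e).
  have [x [[x1 [y Py xy]] lx]] := filter_ex (@filterI _ U _ _ _ UB (hl e e0)).
  by exists x, y.
have ball_rc (x y : X) N : nbhs x N ->
    exists2 e : R, 0 < e & forall y, rnorm (x - y) < e -> N y.
  move=> /nbhs_ballP[e /= e0 he]; have eE := ge0_rc (ltW e0); exists (real_part e).
    by rewrite -(ltr_rc k) -eE rc0.
  move=> z xz; apply: he; rewrite -ball_normE /= -rnormE.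
  by move: xz; rewrite -(ltr_rc k) -eE.
exists l; split.
  move=> N /(ball_rc l l)[e e0 he]; have [x [_ [x1 _ _ lx]]] := near_l setT e filterT e0.
  exists (C x); split; last exact: he.
  by exists x => //=; rewrite -rnormE -(rc1 R k) ler_rc.
move=> P N FP /(ball_rc l l)[e e0 he]; have e2 : 0 < e / 2 by rewrite divr_gt0.
have [x [y [_ Py xy lx]]] := near_l P _ FP e2; exists y; split => //; apply: he.
by apply: le_lt_trans (rdistD (C x) _ _) _; rewrite [ltRHS]splitr ltrD.
Qed.

Lemma compact_operatorD C C' :
  compact_operator C -> compact_operator C' -> compact_operator (C + C').
Proof.
move=> cC cC'; apply: compact_operatorP => U UU U1.
have [y hy] := compact_operator_ultra cC UU U1 (f := id).
have [y' hy'] := compact_operator_ultra cC' UU U1 (f := id).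
by exists (y + y'); apply: cvgD.
Qed.

Lemma compact_operatorZ (a : K) C : compact_operator C -> compact_operator (a *: C).
Proof.
move=> cC; apply: compact_operatorP => U UU U1.
have [y hy] := compact_operator_ultra cC UU U1 (f := id).
by exists (a *: y); apply: cvgZr.
Qed.

Lemma compact_operator0 : compact_operator (0 : endo X).
Proof.
apply: compact_operatorP => U UU U1; exists 0; exact: cvg_cst.
Qed.

Lemma compact_compl T C : compact_operator C -> compact_operator (comp_operator T C).
Proof.
move=> cC; apply: compact_operatorP => U UU U1.
have [y hy] := compact_operator_ultra cC UU U1 (f := id).
exists (T y); apply: (continuous_cvg _ _ hy); exact: operator_continuous.
Qed.

Lemma compact_compr T C : compact_operator C -> compact_operator (comp_operator C T).
Proof.
move=> cC; apply: compact_operatorP => U UU U1.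
apply: (compact_operator_ultra cC UU (f := T) (M := rnorm T)).
by apply: filterS U1 => x; exact: op_rnorm_le1.
Qed.

(** If uniformity failed, an ultrafilter on the bad indices would make the images of their witnesses
    converge to some [w], and the Lipschitz bound would keep [g i w] away from 0. This serves both
    for the resolvents and for the weak-star to norm continuity of adjoints of compact operators. *)
Lemma compact_unif C (I : Type) (F : set_system I) (g : I -> X -> R) (M : R) :
  compact_operator C -> Filter F ->
  (\forall i \near F, forall u w, g i u <= g i w + M * rnorm (u - w)) ->
  (forall w e, 0 < e -> \forall i \near F, g i w <= e) ->
  forall e, 0 < e -> \forall i \near F, forall v, rnorm v <= 1 -> g i (C v) <= e.
Proof.
move=> cC FF lip g0 e e0; apply: contrapT => nF.
pose bad := [set i | exists2 v, rnorm v <= 1 & e < g i (C v)].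
have WF : ProperFilter (within bad F).
  apply: Build_ProperFilter_ex => P WP; apply: contrapT => Pn; apply: nF.
  have {}WP : F [set i | bad i -> P i] := WP.
  apply: filterS WP => i Pi v v1; rewrite leNgt; apply/negP => lt.
  by apply: Pn; exists i; apply: Pi; exists v.
have [U [UU FU]] := ultraFilterLemma WF.
have UF P : F P -> U P by move=> FP; apply: FU; apply: filterS FP => i.
have Ubad : U bad by apply: FU; exact: withinT.
have /choice[v vP] i : exists v, bad i -> rnorm v <= 1 /\ e < g i (C v).
  have [[v v1 lt]|nb] := pselect (bad i); first by exists v.
  by exists 0.
have [|w hw] := compact_operator_ultra cC UU (f := v) (M := 1).
  by apply: filterS Ubad => i /vP[].
have e2 : 0 < e / 2 by rewrite divr_gt0.
have M0 : 0 < `|M| + 1 by rewrite ltr_wpDl.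
have eM : 0 < e / 2 / (`|M| + 1) by rewrite divr_gt0.
move/cvg_rnormP : hw => /(_ _ eM) hw.
have FU' : Filter U by exact: ultra_proper.
have lipU := @filterI _ U FU' _ _ (UF _ lip) (UF _ (g0 w _ e2)).
have badU := @filterI _ U FU' _ _ hw Ubad.
have [i [[li gi] []]] := filter_ex (@filterI _ U FU' _ _ lipU badU).
rewrite /= ltr_pdivlMr// rdistC => lt /vP[_].
apply/negP; rewrite -leNgt; apply: le_trans (li _ w) _; rewrite [leRHS]splitr lerD//.
apply: le_trans (ltW lt); rewrite mulrC ler_wpM2l ?rnorm_ge0//.
by apply: le_trans (ler_norm _) _; rewrite lerDl.
Qed.

End compact_operators.

(** * Fixed vectors of a small operator plus a compact one *)

Section fixed_space.
Variables (R : realType) (k : scalar_kind).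
Local Notation K := (scalars R k).
Local Notation rc := (@of_real R k).
Variable X : normedModType K.
Variables (S C : endo X) (q : R).
Hypotheses (q1 : q < 1) (Sq : rnorm S <= q) (cC : compact_operator C).

Let V := [set v : X | v = S v + C v].

(** [C] is bounded below on [V], which carries total boundedness from the image of the unit ball
    back to the unit ball of [V]. *)
Let V_dist u v : V u -> V v -> (1 - q) * rnorm (u - v) <= rnorm (C u - C v).
Proof.
move=> Vu Vv; have : rnorm (u - v) <= q * rnorm (u - v) + rnorm (C u - C v); last lra.
rewrite {1}Vu {1}Vv opprD addrACA -linearB; apply: le_trans (rnormD _ _) _.
rewrite lerD2r; apply: le_trans (op_rnorm _ _) _.
by rewrite ler_wpM2r// rnorm_ge0.
Qed.

Let VZ a w : V w -> V (a *: w).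
Proof. by move=> Vw; rewrite /V /= [S _]linearZ [C _]linearZ -scalerDr -Vw. Qed.

Let VB u w : V u -> V w -> V (u - w).
Proof.
move=> Vu Vw; rewrite /V /= [S _]linearB [C _]linearB {1}Vu {1}Vw.
by rewrite opprD addrACA.
Qed.

Let net : exists (n : nat) (v : 'I_n -> X),
  (forall i, V (v i)) /\ forall u, V u -> rnorm u <= 1 -> exists i, rnorm (u - v i) <= 1 / 2.
Proof.
pose A := closure [set C x | x in [set x : X | `|x| <= 1]].
have cA : compact A by move: cC; rewrite /compact_operator precompactE.
(* Two vectors of [V] with images [e]-close to the same centre are at distance at most
   [2 * e / (1 - q)], which is 1/2. *)
pose e : R := (1 - q) / 4; have e0 : 0 < e by rewrite divr_gt0// subr_gt0.
have [|s _ sA] := @compact_finite_subcover _ A (fun z => [set w | rnorm (z - w) < e]) cA.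
  move=> z _; have : (fun x : X => x) @ nbhs z --> z by exact: cvg_id.
  by move=> /cvg_rnormP; apply.
have /choice[f fP] z : exists v, V v /\
    ((exists2 v', V v' & rnorm (z - C v') < e) -> rnorm (z - C v) < e).
  have [[v Vv zv]|nv] := pselect (exists2 v', V v' & rnorm (z - C v') < e).
    by exists v.
  by exists 0; split => //; rewrite /V /= !linear0 addr0.
exists (size s), (fun i => f (nth 0 s i)); split; first by move=> i; have [] := fP (nth 0 s i).
move=> u Vu u1; have [|z zs zu] := sA (C u).
  by apply: subset_closure; exists u => //=; rewrite -(rc1 R k) ler_norm_rc.
have ltz : (index z s < size s)%N by rewrite index_mem.
exists (Ordinal ltz); rewrite nth_index//.
have [Vf /(_ _)zf] := fP z; have {}zf : rnorm (z - C (f z)) < e by apply: zf; exists u.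
have := V_dist Vu Vf; have := rdistD z (C u) (C (f z)); rewrite (rdistC (C u) z).
move: zu zf; rewrite /= /e => h1 h2 h3 h4.
have : (1 - q) * rnorm (u - f z) <= (1 - q) * (1 / 2) by lra.
by rewrite ler_pM2l// subr_gt0.
Qed.

Let cvg_rnorm_comb (T : Type) (F : set_system T) n (f : 'I_n -> T -> R)
    (l : 'I_n -> R) (v : 'I_n -> X) (u : X) : Filter F ->
  (forall i, f i t @[t --> F] --> l i) ->
  rnorm (u - \sum_i rc (f i t) *: v i) @[t --> F] -->
  rnorm (u - \sum_i rc (l i) *: v i).
Proof.
move=> FF fl; apply/cvgrPdist_lt => e e0.
have : u - \sum_i rc (f i t) *: v i @[t --> F] --> u - \sum_i rc (l i) *: v i.
  apply: cvgB; first exact: cvg_cst.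
  apply: cvg_sum => i _; apply: cvgZl.
  apply/(@cvg_rnormP R k K^o) => d d0.
  have /cvgrPdist_lt/(_ d d0) := fl i; apply: filterS => t lt /=.
  suff : rnorm (rc (l i - f i t) : K^o) < d by rewrite rcB.
  by rewrite /rnorm normr_rc rcK.
move=> /cvg_rnormP/(_ e e0); apply: (@filterS _ F) => t /=; apply: le_lt_trans.
set a := u - _; set b := u - _; rewrite ler_norml.
have := rnormD (a - b) b; have := rnormD (b - a) a; rewrite !subrK (rdistC b).
by move=> h1 h2; apply/andP; split; lra.
Qed.

(* A finite 1/2-net [v] of the unit ball gives expansions
   [u = v i0 + v i1 / 2 + v i2 / 4 + ...], so that [v] spans. *)
Lemma fixed_space_finite : exists (n : nat) (v : 'I_n -> X),
  forall u, u = S u + C u -> exists c : 'I_n -> K, u = \sum_(i < n) c i *: v i.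
Proof.
have [n [v [Vv hv]]] := net; exists n, v.
(* The bound is [1 + 1/2 + ...] with [m] terms, reached when the same net point is chosen every
   time. So all coefficients stay in the compact box of side 2, on which the distance to [u] attains
   its minimum; [exact_span] shows that this is 0. *)
have approx m u : V u -> rnorm u <= 1 -> exists c : 'I_n -> R,
    (forall i, 0 <= c i <= 2 - 2 / 2 ^+ m) /\
    rnorm (u - \sum_i rc (c i) *: v i) <= 1 / 2 ^+ m.
  elim: m u => [|m IHm] u Vu u1.
    exists (fun=> 0); split => [i|].
      by rewrite expr0 divr1 subrr lexx.
    by rewrite big1 ?subr0 ?expr0 ?divr1// => i _; rewrite rc0 scale0r.
  have [i0 hi] := hv u Vu u1.
  pose u' := rc 2 *: (u - v i0).
  have [||c [c2 cu]] := IHm u'.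
  - exact/VZ/VB.
  - by rewrite /u' rnormZr ger0_norm//; lra.
  exists (fun i => (i == i0)%:R + c i / 2); split => [i|].
    have /andP[h1 h2] := c2 i; rewrite exprS invfM; rewrite [X in _ - X]mulrCA.
    move: (2 / 2 ^+ m) h2 => t h2.
    by case: eqP => _; rewrite /= ?mulr1n ?mulr0n; apply/andP; split; try lra.
  rewrite (_ : u - _ = rc 2^-1 *: (u' - \sum_i rc (c i) *: v i)).
    rewrite rnormZr gtr0_norm// exprS invfM !mul1r ler_pM2l//.
    by move: cu; rewrite mul1r.
  rewrite /u' scalerBr scalerA -rcM mulVf ?pnatr_eq0// rc1 scale1r.
  rewrite scaler_sumr -addrA -opprD; congr (_ - _).
  under eq_bigr do rewrite rcD scalerDl.
  rewrite big_split /=; congr (_ + _).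
    rewrite (bigD1 i0)//= eqxx rc1 scale1r big1 ?addr0// => i /negbTE ->.
    by rewrite rc0 scale0r.
  by apply: eq_bigr => i _; rewrite scalerA -rcM mulrC.
have exact_span u : V u -> rnorm u <= 1 -> exists c : 'I_n -> K, u = \sum_i c i *: v i.
  move=> Vu u1; pose g (c : 'rV[R]_n) := rnorm (u - \sum_i rc (c 0 i) *: v i).
  pose A := [set c : 'rV[R]_n | forall i, `[0, 2]%classic (c ord0 i)].
  have cA : compact A.
    exact: (@rV_compact R n (fun=> `[0, 2]%classic) (fun=> @segment_compact R 0 2)).
  have gcont : continuous g.
    move=> c; apply: (@cvg_rnorm_comb _ (nbhs c) _ (fun i c' => c' 0 i)) => i.
    exact: coord_continuous.
  have in_A (c : 'I_n -> R) m : (forall i, 0 <= c i <= 2 - 2 / 2 ^+ m) -> A (\row_i c i).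
    move=> h i /=; rewrite mxE in_itv /=; have /andP[-> h2] := h i.
    by apply: le_trans h2 _; rewrite gerBl divr_ge0// exprn_ge0.
  have [|c _ cmin] := compact_EVT_min _ cA (continuous_subspaceT gcont).
    by have [c [/in_A cA' _]] := approx 0 u Vu u1; exists (\row_i c i).
  exists (fun i => rc (c 0 i)); apply/eqP; rewrite -subr_eq0 -rnorm_eq0.
  rewrite eq_le rnorm_ge0 andbT -/(g c) leNgt; apply/negP => lt.
  have [m hm] : exists m, 1 / 2 ^+ m < g c.
    have /cvgrPdist_lt/(_ _ lt)[m _ hm] : (2^-1 : R) ^+ m @[m --> \oo] --> (0 : R).
      by apply: cvg_expr; rewrite gtr0_norm// invf_lt1// ltr1n.
    exists m; have := hm m (leqnn m); rewrite sub0r normrN gtr0_norm ?exprn_gt0//.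
    by rewrite exprVn div1r.
  have [c' [/in_A cA' cu]] := approx m u Vu u1.
  have := cmin _ (mem_set cA'); rewrite leNgt => /negP; apply.
  apply: le_lt_trans hm; move: cu; rewrite /g.
  by under [X in _ -> rnorm (_ - X) <= _]eq_bigr do rewrite mxE.
move=> u Vu; have [->|u0] := eqVneq u 0.
  by exists (fun=> 0); rewrite big1// => i _; rewrite scale0r.
have nu : 0 < rnorm u by rewrite rnorm_gt0.
have [||c cE] := exact_span (rc (rnorm u)^-1 *: u).
- exact: VZ.
- by rewrite rnormZr gtr0_norm ?invr_gt0// mulVf// gt_eqF.
exists (fun i => rc (rnorm u) * c i); under eq_bigr do rewrite -scalerA.
by rewrite -scaler_sumr -cE scalerA -rcM divff ?gt_eqF// rc1 scale1r.
Qed.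
End fixed_space.

(** * Finite rank operators in a closed algebra *)

Section contraction.
Variables (R : realType) (k : scalar_kind).
Local Notation K := (scalars R k).
Local Notation rc := (@of_real R k).
Variable V : normedModType K.
Hypothesis bV : banach V.

Lemma banach_seq (z : nat -> V) (a : nat -> R) :
  a n @[n --> \oo] --> (0 : R) ->
  (forall n m, (n <= m)%N -> rnorm (z n - z m) <= a n) ->
  exists l : V, z n @[n --> \oo] --> l.
Proof.
move=> a0 za; apply: bV => e e0.
have /cvgrPdist_lt/(_ e e0)[N _ hN] := a0.
exists (z N), N => // m /= Nm; apply: le_lt_trans (za _ _ Nm) _.
by have := hN N (leqnn N); rewrite sub0r normrN /=; apply: le_lt_trans; exact: ler_norm.
Qed.

Lemma contraction_fixpoint (D : set V) (g : V -> V) (c : R) :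
  closed D -> D !=set0 -> (forall x, D x -> D (g x)) -> 0 <= c < 1 ->
  (forall x y, rnorm (g x - g y) <= c * rnorm (x - y)) ->
  exists2 x, D x & g x = x.
Proof.
move=> cD [x0 Dx0] gD /andP[c0 c1] gc.
pose z n := iter n g x0; pose d := rnorm (z 0%N - z 1%N).
have Dz n : D (z n) by elim: n => //= n; exact: gD.
have zS n : rnorm (z n - z n.+1) <= c ^+ n * d.
  elim: n => [|n IHn]; first by rewrite expr0 mul1r.
  by apply: le_trans (gc _ _) _; rewrite exprS -mulrA ler_wpM2l.
have c1' : 0 < 1 - c by rewrite subr_gt0.
have zz n m : rnorm (z n - z (n + m)%N) <= c ^+ n * (d / (1 - c)).
  elim: m n => [|m IHm] n.
    by rewrite addn0 subrr rnorm0 mulr_ge0 ?exprn_ge0// divr_ge0 ?rnorm_ge0// ltW.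
  rewrite addnS -addSn; apply: le_trans (rdistD (z n.+1) _ _) _.
  apply: le_trans (lerD (zS n) (IHm n.+1)) _; rewrite exprSr -mulrA -mulrDr.
  rewrite ler_wpM2l ?exprn_ge0//.
  rewrite (_ : d + c * (d / (1 - c)) = d / (1 - c))//.
  by field; rewrite gt_eqF.
have [||l zl] := @banach_seq z (fun n => c ^+ n * (d / (1 - c))).
- rewrite -(mul0r (d / (1 - c))); apply: cvgMl; apply: cvg_expr.
  by rewrite ger0_norm.
- by move=> n m nm; have := zz n (m - n)%N; rewrite subnKC.
exists l; first by apply: (closed_cvg D cD _ l zl); exact: nearW.
apply/eqP; rewrite -subr_eq0 -rnorm_eq0 eq_le rnorm_ge0 andbT.
apply/ler_addgt0Pr => e e0; rewrite add0r.
have e2 : 0 < e / 2 by rewrite divr_gt0.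
move/cvg_rnormP: zl => /(_ _ e2)[N _ hN].
have := hN N (leqnn N); have := hN N.+1 (leqnSn N); rewrite /=.
have := gc l (z N); have := rdistD (g (z N)) (g l) l.
rewrite [rnorm (g (z N) - l)]rdistC -/(z N.+1).
have : c * rnorm (l - z N) <= rnorm (l - z N) by rewrite ler_piMl ?rnorm_ge0// ltW.
lra.
Qed.
End contraction.

(** * Resolvents in the algebra and their limit *)

Section endgame.
Variables (R : realType) (k : scalar_kind).
Local Notation K := (scalars R k).
Local Notation rc := (@of_real R k).
Variable X : completeNormedModType K.
Variable A : set (endo X).
Hypotheses (algA : operator_algebra A) (closedA : closed A).

Let banach_endo : banach (endo X).
Proof. by apply: banach_op; exact: banach_complete. Qed.

Section resolvent.
Variable T : endo X.
Hypothesis AT : A T.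

Let B := [set Z | A Z /\ forall x, Z (T x) = T (Z x)].

(** [Z] is [T (1 - t T)^-1], and [1 + t Z] inverts [1 - t T]. The factor [T] keeps the resolvent
    inside an algebra that may lack the identity. *)
Let I (t : R) (Z : endo X) := B Z /\ Z = T + rc t *: comp_operator T Z.

Let closedB : closed B.
Proof.
move=> Z clZ; split.
  by apply: closedA => N /clZ[W [[AW _] NW]]; exists W.
move=> x; apply/eqP; rewrite -subr_eq0 -rnorm_eq0 eq_le rnorm_ge0 andbT.
apply/ler_addgt0Pr => e e0; rewrite add0r.
pose M := (rnorm (T x) + rnorm T * rnorm x) + 1.
have M0 : 0 < M by rewrite ltr_wpDl// addr_ge0 ?mulr_ge0 ?rnorm_ge0.
have eM : 0 < e / M by rewrite divr_gt0.
have : (fun W : endo X => W) @ nbhs Z --> Z by exact: cvg_id.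
move=> /cvg_rnormP/(_ _ eM)/clZ[W [[_ WT]]]; rewrite /= ltr_pdivlMr// => lt.
have -> : Z (T x) - T (Z x) = (Z - W) (T x) - T ((Z - W) x).
  rewrite -[(Z - W) (T x)]/(Z (T x) - W (T x)) -[(Z - W) x]/(Z x - W x).
  by rewrite (opB T) WT opprB addrA subrK.
apply: le_trans (rnormB _ _) _; apply: le_trans (ltW lt).
rewrite /M mulrDr mulr1 -[leLHS]addr0 lerD ?rnorm_ge0//.
rewrite mulrDr lerD ?op_rnorm//; apply: le_trans (op_rnorm _ _) _.
by rewrite mulrCA ler_wpM2l ?rnorm_ge0// op_rnorm.
Qed.

(** The resolvent identity [W = Z + (s - t) Z W] is a contraction in [W]; solving it inside the
    closed set [B] keeps [W] in [A] and commuting with [T]. *)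
Let I_open t s Z : I t Z -> `|s - t| * rnorm Z < 1 -> exists Z', I s Z'.
Proof.
move=> [[AZ ZT] ZE] lt; have [_ lA mA] := algA.
pose h := s - t; pose g (W : endo X) := rc h *: comp_operator Z W + Z.
have [|W||W W'|W [AW WT] gW] :=
  @contraction_fixpoint _ _ _ banach_endo B g (`|h| * rnorm Z) closedB.
- by exists Z.
- move=> [AW WT]; split; first by apply: lA => //; exact: mA.
  move=> x; rewrite -[g W (T x)]/(rc h *: Z (W (T x)) + Z (T x)).
  rewrite -[g W x]/(rc h *: Z (W x) + Z x).
  by rewrite (opD T) (opZ T) /= WT !ZT.
- by rewrite lt mulr_ge0 ?rnorm_ge0.
- have -> : g W - g W' = rc h *: comp_operator Z (W - W').
    apply: op_eq => x; rewrite -[LHS]/((rc h *: Z (W x) + Z x) - (rc h *: Z (W' x) + Z x)).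
    rewrite -[RHS]/(rc h *: Z (W x - W' x)).
    by rewrite (opB Z) scalerBr opprD addrACA subrr addr0.
  by rewrite rnormZr -mulrA ler_wpM2l// comp_rnorm.
exists W; split => //; apply: op_eq => x.
have Wx v : W v = rc h *: Z (W v) + Z v by rewrite -{1}gW.
have Zx v : Z v = T v + rc t *: T (Z v) by rewrite {1}ZE.
have TW : rc t *: T (W x) = W x - T x - rc h *: T (W x).
  have e1 : T (W x) = rc h *: T (Z (W x)) + T (Z x).
    by rewrite {1}Wx (opD T) (opZ T).
  have tTZ v : rc t *: T (Z v) = Z v - T v by rewrite {2}Zx addrC addKr.
  rewrite {1}e1 scalerDr scalerA mulrC -scalerA !tTZ scalerBr.
  by rewrite addrACA -Wx [- _ - _]addrC addrA.
rewrite -[RHS]/(T x + rc s *: T (W x)).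
have -> : s = t + h by rewrite /h addrC subrK.
by rewrite rcD scalerDl TW subrK addrC subrK.
Qed.

(* [t] is the infimum of the parameters without a resolvent [T (1 - t T)^-1] in
   the algebra, and [Q n] is the normalised resolvent at some [s_n] tending to [t]
   from below: its norm blows up by [I_open]. *)
Lemma resolvent_blowup (y : dual X) : y <> 0 -> (forall x, y (T x) = y x) ->
  exists (t : R) (Q D : nat -> endo X), [/\ 0 < t <= 1,
   (forall n, [/\ A (Q n), rnorm (Q n) = 1 & forall x, Q n (T x) = T (Q n x)]),
   (forall n x, Q n x = rc t *: T (Q n x) + D n x) &
   forall n, rnorm (D n) <= 2 * rnorm T / n.+1%:R].
Proof.
move=> y0 yT.
have I0 : I 0 T by split => //; rewrite rc0 scale0r addr0.
(* Applying [y] to [Z = T + T Z] gives [y Z = y + y Z], hence [y = 0]. *)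
have I1 Z : ~ I 1 Z.
  move=> [_ ZE]; apply: y0; apply: op_eq => x.
  have : y (Z x) = y x + y (Z x).
    have Zx : Z x = T x + rc 1 *: T (Z x) by rewrite {1}ZE.
    by rewrite {1}Zx rc1 scale1r (opD y) !yT.
  by move/eqP; rewrite -subr_eq subrr eq_sym => /eqP.
pose E := [set t : R | 0 <= t <= 1 /\ forall Z, ~ I t Z].
have E1 : E 1 by split => //; rewrite ler01 lexx.
have hE : has_inf E by split; [exists 1|exists 0 => t [/andP[]]].
pose t0 := inf E.
have t0_ge0 : 0 <= t0 by apply: lb_le_inf; [exists 1|move=> t [/andP[]]].
have t0_le1 : t0 <= 1 by apply: ge_inf => //; case: hE.
have below t : 0 <= t < t0 -> exists Z, I t Z.
  move=> /andP[t_ge0 tt0]; apply: contrapT => nI.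
  suff : t0 <= t by rewrite leNgt tt0.
  apply: ge_inf; first by case: hE.
  split; first by rewrite t_ge0 (le_trans (ltW tt0)).
  by move=> Z IZ; apply: nI; exists Z.
(* Otherwise [I_open] would reach beyond [t0]: [d] is such that [(t0 + d - t) * rnorm Z < 1], while
   some parameter of [E] lies below [t0 + d]. *)
have blow t Z : t <= t0 -> I t Z -> 1 <= (t0 - t) * rnorm Z.
  move=> tt0 IZ; rewrite leNgt; apply/negP => lt.
  pose d := (1 - (t0 - t) * rnorm Z) / (rnorm Z + 1).
  have Z1 : 0 < rnorm Z + 1 by rewrite ltr_wpDl ?rnorm_ge0.
  have d0 : 0 < d by rewrite divr_gt0// subr_gt0.
  have [s [/andP[s0 s1] nI] st] := inf_adherent d0 hE.
  have t0s : t0 <= s by apply: ge_inf; [case: hE|split => //; rewrite s0].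
  have [|Z' /nI//] := I_open IZ (s := s).
  rewrite ger0_norm ?subr_ge0 ?(le_trans tt0)//.
  have h1 : (s - t) * rnorm Z <= (t0 - t) * rnorm Z + d * rnorm Z.
    rewrite -mulrDl ler_wpM2r ?rnorm_ge0//; move: st; rewrite -/t0; lra.
  have h2 : d * rnorm Z < 1 - (t0 - t) * rnorm Z.
    rewrite /d -mulrA gtr_pMr ?subr_gt0// mulrC ltr_pdivrMr// mul1r ltrDl //.
  lra.
have t0_gt0 : 0 < t0.
  rewrite lt_def t0_ge0 andbT; apply/eqP => t00.
  by have := blow 0 T t0_ge0 I0; rewrite t00 subrr mul0r ler10.
pose u n : R := n.+1%:R^-1.
have u0 n : 0 < u n by rewrite invr_gt0.
have u1 n : u n <= 1 by rewrite invf_le1// ler1n.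
have /choice[Z hZ] n : exists Z, I (t0 * (1 - u n)) Z.
  apply: below; rewrite mulr_ge0 ?subr_ge0//= gtr_pMr//.
  by rewrite ltrBlDr ltrDl.
have Zbig n : 1 <= t0 * u n * rnorm (Z n).
  have := blow _ _ _ (hZ n); rewrite (_ : t0 - _ = t0 * u n); last by ring.
  by apply; rewrite ler_piMr// gerBl ltW.
have r0 n : 0 < rnorm (Z n).
  rewrite lt_def rnorm_ge0 andbT; apply/eqP => z0.
  by have := Zbig n; rewrite z0 mulr0 ler10.
have rinv n : (rnorm (Z n))^-1 <= u n.
  have h : 1 <= u n * rnorm (Z n).
    apply: le_trans (Zbig n) _; rewrite -mulrA ler_piMl// mulr_ge0 ?rnorm_ge0//.
    exact: ltW.
  by rewrite -[leLHS]mul1r ler_pdivrMr.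
pose Q n := rc (rnorm (Z n))^-1 *: Z n.
(* [Z n] solves its equation at [t0 * (1 - u n)]. [D n] is the normalised inhomogeneous term
   together with the cost of replacing that parameter by [t0]. *)
pose D n := rc (rnorm (Z n))^-1 *: T - rc (t0 * u n) *: comp_operator T (Q n).
have [_ lA mA] := algA.
have Q1 n : rnorm (Q n) = 1.
  by rewrite rnormZr gtr0_norm ?invr_gt0// mulVf// gt_eqF.
exists t0, Q, D; split => [|n|n x|n].
- by rewrite t0_gt0.
- have [[AZ ZT] _] := hZ n; split => //.
    by rewrite /Q -[_ *: Z n]addr0; apply: lA => //; case: algA.
  move=> x; rewrite -[LHS]/(rc (rnorm (Z n))^-1 *: Z n (T x)).
  by rewrite -[Q n x]/(rc (rnorm (Z n))^-1 *: Z n x) (opZ T) /= ZT.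
- have [_ ZE] := hZ n; set r := rc (rnorm (Z n))^-1.
  have Qx : Q n x = r *: Z n x by [].
  have Zx : Z n x = T x + rc (t0 * (1 - u n)) *: T (Z n x) by rewrite {1}ZE.
  have QE : Q n x = r *: T x + rc (t0 * (1 - u n)) *: T (Q n x).
    by rewrite {1}Qx {1}Zx scalerDr Qx (opZ T) !scalerA [r * _]mulrC.
  rewrite {1}QE -[D n x]/(r *: T x - rc (t0 * u n) *: T (Q n x)).
  by rewrite mulrBr mulr1 rcB scalerBl addrCA.
- have h : t0 * u n <= u n by rewrite ler_piMl// ltW.
  apply: le_trans (rnormB _ _) _; rewrite !rnormZr.
  rewrite gtr0_norm ?invr_gt0// gtr0_norm ?mulr_gt0//.
  have := comp_rnorm T (Q n); rewrite Q1 mulr1 => hT.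
  have -> : 2 * rnorm T / n.+1%:R = u n * rnorm T + u n * rnorm T.
    by rewrite /u; ring.
  apply: lerD; first by rewrite ler_wpM2r ?rnorm_ge0.
  by apply: ler_pM => //; rewrite ?rnorm_ge0// mulr_ge0// ltW.
Qed.
End resolvent.

Lemma fixed_functional_finite_rank (T S C : endo X) (q : R) (y : dual X) :
  A T -> T = S + C -> q < 1 -> rnorm S <= q -> compact_operator C ->
  y <> 0 -> (forall x, y (T x) = y x) ->
  exists L : endo X, [/\ A L, finite_rank L & L <> 0].
Proof.
move=> AT TE q1 Sq cC y0 yT.
have [t [Q [D [/andP[t0 t1] hQ QE Dle]]]] := resolvent_blowup AT y0 yT.
have [S' S'E] : exists S' : endo X, S' = rc t *: S by eexists.
have [C' C'E] : exists C' : endo X, C' = rc t *: C by eexists.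
have cC' : compact_operator C' by rewrite C'E; exact: compact_operatorZ.
have S'q : rnorm S' <= q.
  apply: le_trans Sq; rewrite S'E rnormZr gtr0_norm//.
  by rewrite ler_piMl ?rnorm_ge0.
have tT x : rc t *: T x = S' x + C' x.
  by rewrite TE S'E C'E -[(S + C) x]/(S x + C x) scalerDr.
have {}QE n x : Q n x = S' (Q n x) + C' (Q n x) + D n x by rewrite {1}QE tT.
have QC n x : Q n (S' x + C' x) = S' (Q n x) + C' (Q n x).
  by have [_ _ QT] := hQ n; rewrite -!tT opZ QT.
have D0 e : 0 < e -> \forall n \near \oo, rnorm (D n) <= e.
  move=> e0; have : 2 * rnorm T * n.+1%:R^-1 @[n --> \oo] --> (2 * rnorm T * 0 : R).
    by apply: cvgMr; exact: cvg_harmonic.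
  rewrite mulr0 => /cvgrPdist_le/(_ _ e0); apply: filterS => n.
  by rewrite sub0r normrN; apply: le_trans; apply: le_trans (Dle n) (ler_norm _).
have [U [UU oU]] := ultraFilterLemma (@eventually_filter : ProperFilter \oo).
have pointwise x : exists l : X, C' (Q n x) @[n --> U] --> l.
  apply: (compact_operator_ultra cC' UU (f := fun n => Q n x) (M := rnorm x)).
  apply: nearW => n; have [_ Q1 _] := hQ n.
  by apply: le_trans (op_rnorm _ _) _; rewrite Q1 mul1r.
(* [C' (Q n x)] converges for each [x]; a compact factor on the right makes this uniform on the unit
   ball. *)
have unif e : 0 < e -> \forall nm \near (U, U), forall v, rnorm v <= 1 ->
    rnorm (C' ((Q nm.1 - Q nm.2) (C' v))) <= e.
  move: e; apply: (@compact_unif _ _ _ _ _ (filter_prod U U)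
    (fun nm w => rnorm (C' ((Q nm.1 - Q nm.2) w))) (rnorm C' * 2) cC').
    apply: nearW => -[n m] u w; rewrite [(n, m).1]/= [(n, m).2]/=.
    move: (Q n - Q m) (rnormB (Q n) (Q m)); have [_ -> _] := hQ n; have [_ -> _] := hQ m.
    move=> W W2; have -> : W u = W w + W (u - w) by rewrite (opB W) addrC subrK.
    rewrite (opD C'); apply: le_trans (rnormD _ _) _; rewrite lerD2l.
    apply: le_trans (op_rnorm _ _) _; rewrite -mulrA ler_wpM2l ?rnorm_ge0//.
    by apply: le_trans (op_rnorm _ _) _; rewrite ler_wpM2r ?rnorm_ge0.
  move=> w d d0; have d2 : 0 < d / 2 by rewrite divr_gt0.
  have [l /cvg_rnormP/(_ _ d2) hl] := pointwise w.
  exists ([set n | rnorm (l - C' (Q n w)) < d / 2],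
          [set n | rnorm (l - C' (Q n w)) < d / 2]).
    by split.
  move=> [n m] [/= hn hm]; suff : rnorm (C' (Q n w) - C' (Q m w)) <= d by rewrite -(opB C').
  apply: le_trans (rdistD l _ _) _; rewrite rdistC.
  by rewrite [leRHS]splitr lerD// ltW.
have q10 : 0 < 1 - q by rewrite subr_gt0.
have q0 : 0 <= q by apply: le_trans S'q; exact: rnorm_ge0.
(* [W = Q n - Q m] satisfies [W = S' W + C' W + O(d)], and composing with [C'],
   [C' W = (C' W) S' + C' W C' + O(d)] since [W] commutes with [S' + C']; this
   bounds |W| by |C' W C'|, and [unif] makes the latter small. *)
have key n m e d : 0 <= e -> (forall v, rnorm v <= 1 ->
    rnorm (C' ((Q n - Q m) (C' v))) <= e) -> rnorm (D n) <= d -> rnorm (D m) <= d ->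
    (1 - q) * ((1 - q) * rnorm (Q n - Q m)) <= e + (rnorm C' + (1 - q)) * (2 * d).
  move=> e0 hC hn hm; set W := Q n - Q m.
  have DD : rnorm (D n - D m) <= 2 * d by apply: le_trans (rnormB _ _) _; lra.
  have Wx x : W x = S' (W x) + C' (W x) + (D n - D m) x.
    rewrite -[W x]/(Q n x - Q m x) -[(_ - D m) x]/(D n x - D m x) {1}QE {1}(QE m).
    rewrite opprD addrACA (opB S') (opB C'); congr (_ + _).
    by rewrite opprD addrACA.
  have WC x : W (S' x + C' x) = S' (W x) + C' (W x).
    rewrite -[W x]/(Q n x - Q m x) -[LHS]/(Q n (S' x + C' x) - Q m (S' x + C' x)).
    by rewrite !QC (opB S') (opB C') opprD addrACA.
  have C'W0 : 0 <= rnorm (comp_operator C' W) by exact: rnorm_ge0.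
  have h1 : rnorm W <= q * rnorm W + rnorm (comp_operator C' W) + 2 * d.
    apply: op_rnorm_le => [|x x1].
      rewrite !addr_ge0 ?mulr_ge0 ?rnorm_ge0 ?(le_trans _ S'q) ?rnorm_ge0//.
      by apply: le_trans hn; exact: rnorm_ge0.
    rewrite Wx; apply: le_trans (rnormD _ _) _; apply: lerD; last first.
      by apply: le_trans DD; exact: op_rnorm_le1.
    apply: le_trans (rnormD _ _) _; apply: lerD; last first.
      exact: (@op_rnorm_le1 _ _ _ _ (comp_operator C' W)).
    apply: le_trans (op_rnorm _ _) _.
    by apply: ler_pM; rewrite ?rnorm_ge0//; exact: op_rnorm_le1.
  have h2 : rnorm (comp_operator C' W) <=
      q * rnorm (comp_operator C' W) + e + rnorm C' * (2 * d).
    have dd0 : 0 <= 2 * d by apply: le_trans DD; exact: rnorm_ge0.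
    apply: op_rnorm_le => [|x x1].
      rewrite !addr_ge0//; first by rewrite mulr_ge0.
      by rewrite mulr_ge0// rnorm_ge0.
    rewrite -[comp_operator C' W x]/(C' (W x)) Wx -WC (opD C') (opD W) (opD C').
    apply: le_trans (rnormD _ _) _; apply: lerD; last first.
      apply: le_trans (op_rnorm _ _) _; rewrite ler_wpM2l ?rnorm_ge0//.
      by apply: le_trans DD; exact: op_rnorm_le1.
    apply: le_trans (rnormD _ _) _; apply: lerD; last exact: hC.
    apply: le_trans (op_rnorm (comp_operator C' W) (S' x)) _.
    rewrite mulrC ler_wpM2r ?rnorm_ge0//.
    by apply: le_trans S'q; exact: op_rnorm_le1.
  have h1' : (1 - q) * rnorm W <= rnorm (comp_operator C' W) + 2 * d by lra.
  have := ler_wpM2l (ltW q10) h1'; move: h2; lra.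
have [L QL] : exists L : endo X, Q n @[n --> U] --> L.
  apply: banach_endo => e e0.
  pose a := (1 - q) * (1 - q); have a0 : 0 < a by rewrite mulr_gt0.
  pose b := rnorm C' + (1 - q); have b0 : 0 < b by rewrite ltr_wpDl ?rnorm_ge0.
  (* With these tolerances [key] bounds [a * rnorm (Q n - Q m)] by [a * e / 2]. *)
  have e1 : 0 < a * e / 4 by rewrite divr_gt0// mulr_gt0.
  have d1 : 0 < a * e / 8 / b by rewrite !divr_gt0// mulr_gt0.
  have [[P1 P2] /= [UP1 UP2] hP] := unif _ e1.
  have [n [P1n Dn]] := filter_ex (filterI UP1 (oU _ (D0 _ d1))).
  exists (Q n); apply: filterS (filterI UP2 (oU _ (D0 _ d1))) => m [P2m Dm].
  have := key n m _ _ (ltW e1) (hP (n, m) (conj P1n P2m)) Dn Dm.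
  have -> : (rnorm C' + (1 - q)) * (2 * (a * e / 8 / b)) = a * e / 4.
    by rewrite -/b; field; rewrite gt_eqF.
  rewrite [leLHS]mulrA -/a => h.
  have : a * rnorm (Q n - Q m) < a * e.
    have := mulr_gt0 a0 e0; move: h => /=; lra.
  by rewrite ltr_pM2l.
have QLx x : Q n x @[n --> U] --> L x by apply: (cvg_op_eval (F := Q @ U)).
exists L; split.
- by apply: (closed_cvg A closedA _ L QL); apply: nearW => n; have [] := hQ n.
- have [m [v hv]] := fixed_space_finite q1 S'q cC'; exists m, v => x; apply: hv.
  have D0x : D n x @[n --> U] --> (0 : X).
    apply/cvg_rnormP => e e0; have d0 : 0 < rnorm x + 1 by rewrite ltr_wpDl ?rnorm_ge0.
    have ed : 0 < e / (rnorm x + 1) by rewrite divr_gt0.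
    have := oU _ (D0 _ ed); apply: (@filterS _ U) => n h.
    suff : rnorm (D n x) < e by rewrite /= sub0r rnormN.
    apply: le_lt_trans (op_rnorm _ _) _.
    apply: (@le_lt_trans _ _ (e / (rnorm x + 1) * rnorm x)).
      by rewrite ler_wpM2r ?rnorm_ge0.
    by rewrite -mulrA gtr_pMr// mulrC ltr_pdivrMr// mul1r ltrDl.
  have : S' (Q n x) + C' (Q n x) + D n x @[n --> U] --> S' (L x) + C' (L x) + 0.
    apply: cvgD D0x; apply: cvgD.
      by apply: (continuous_cvg _ _ (QLx x)); exact: operator_continuous.
    by apply: (continuous_cvg _ _ (QLx x)); exact: operator_continuous.
  rewrite addr0; have -> : (fun n => S' (Q n x) + C' (Q n x) + D n x) = (fun n => Q n x).
    by apply/funext => n; rewrite [RHS]QE.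
  by move=> h; exact: (cvg_unique _ (QLx x) h).
- move=> L0; move/cvg_rnormP: QL => /(_ 1 ltr01) h.
  have [n] := @filter_ex _ U _ _ h.
  by rewrite /= L0 sub0r rnormN; have [_ -> _] := hQ n; rewrite ltxx.
Qed.
End endgame.

(** * Support points of convex sets *)

Section hahn_banach.
Variables (R : realType) (k : scalar_kind).
Local Notation K := (scalars R k).
Local Notation rc := (@of_real R k).
Variable V : lmodType K.

Definition sublinear (q : V -> R) :=
  (forall x y, q (x + y) <= q x + q y) /\
  (forall t x, 0 < t -> q (rc t *: x) <= t * q x).

Lemma sublinear0 q : sublinear q -> q 0 = 0.
Proof.
move=> [qD qZ]; have h2 : 0 < (2 : R)^-1 by rewrite invr_gt0.
have := qD 0 0; have := qZ 2^-1 0 h2; rewrite scaler0 addr0; lra.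
Qed.

Lemma sublinearN q x : sublinear q -> - q (- x) <= q x.
Proof.
move=> sq; have := sublinear0 sq; case: (sq) => [qD _] q0.
by have := qD x (- x); rewrite subrr q0; lra.
Qed.

Lemma inf_leP (E : set R) b x : lbound E b -> E x -> inf E <= x.
Proof. by move=> Eb Ex; apply: ge_inf => //; exists b. Qed.

(** The single [g i] need not be sublinear, only the family be stable under sums and dilations. This
    covers chains in Zorn's lemma, the comparison functional of [hahn_banach], and the functional in
    [support_point]. *)
Lemma sublinear_inf (I : Type) (D : set I) (g : I -> V -> R) (b : V -> R) :
  D !=set0 -> (forall i x, D i -> b x <= g i x) ->
  (forall i j x y, D i -> D j -> exists2 l, D l & g l (x + y) <= g i x + g j y) ->
  (forall i t x, D i -> 0 < t -> exists2 l, D l & g l (rc t *: x) <= t * g i x) ->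
  sublinear (fun x => inf [set g i x | i in D]).
Proof.
move=> [i0 Di0] bg gD gZ.
have lb x : lbound [set g i x | i in D] (b x) by move=> _ [i Di <-]; exact: bg.
have ne x : [set g i x | i in D] !=set0 by exists (g i0 x), i0.
have le_inf i x : D i -> inf [set g i x | i in D] <= g i x.
  by move=> Di; apply: inf_leP (lb x) _; exists i.
split=> [x y|t x t0].
  rewrite -lerBlDr; apply: lb_le_inf => // _ [i Di <-].
  rewrite lerBlDr -lerBlDl; apply: lb_le_inf => // _ [j Dj <-].
  rewrite lerBlDl; have [l Dl gl] := gD i j x y Di Dj.
  by apply: le_trans gl; exact: le_inf.
rewrite -ler_pdivrMl//; apply: lb_le_inf => // _ [i Di <-].
rewrite ler_pdivrMl//; have [l Dl gl] := gZ i t x Di t0.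
by apply: le_trans gl; exact: le_inf.
Qed.

(* Zorn replaces the usual extension argument: a minimal sublinear functional
   is additive, by comparison with [x |-> inf_(t >= 0) q (x + t v) - t q v]. *)
Lemma min_sublinear p : sublinear p -> exists q, [/\ sublinear q,
  (forall x, q x <= p x) &
  forall q', sublinear q' -> (forall x, q' x <= q x) -> q' = q].
Proof.
move=> sp; pose T := {q : V -> R | sublinear q /\ forall x, q x <= p x}.
pose le (q q' : T) := `[< forall x, sval q' x <= sval q x >].
have [|r s t /asboolP h1 /asboolP h2|[q hq] [q' hq'] /asboolP h1 /asboolP h2|A totA|
  [q [sq qp]] qmin] := @Zorn T le.
- by move=> t; apply/asboolP.
- by apply/asboolP => x; exact: le_trans (h2 x) (h1 x).
- by apply: eq_exist; apply/funext => x; apply/eqP; rewrite eq_le h1 h2.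
- have [->|/set0P[a Aa]] := eqVneq A set0.
    by exists (exist _ p (conj sp (fun x => lexx _))).
  pose q x := inf [set sval r x | r in A].
  have lb r x : A r -> - p (- x) <= sval r x.
    move=> _; have [sr rp] := svalP r; apply: le_trans (sublinearN x sr).
    by rewrite lerN2.
  have sq : sublinear q.
    apply: (@sublinear_inf _ A (fun r => sval r) (fun x => - p (- x))) => //.
    + by exists a.
    + move=> i j x y Ai Aj; have [[si _] [sj _]] := (svalP i, svalP j).
      have [/asboolP ij|/asboolP ji] := totA i j Ai Aj.
        by exists j => //; apply: le_trans (sj.1 _ _) _; rewrite lerD2r.
      by exists i => //; apply: le_trans (si.1 _ _) _; rewrite lerD2l.
    + move=> i t x Ai t0; exists i => //; have [[_ iZ] _] := svalP i; exact: iZ.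
  have qA r x : A r -> q x <= sval r x.
    by move=> Ar; apply: (@inf_leP _ (- p (- x))) => [_ [s As <-]|]; [exact: lb|exists r].
  have qp x : q x <= p x.
    by apply: le_trans (qA a x Aa) _; have [_ ] := svalP a.
  by exists (exist _ q (conj sq qp)) => r Ar; apply/asboolP => x; exact: qA.
exists q; split => // q' sq' q'q.
have q'p x : q' x <= p x by exact: le_trans (q'q x) (qp x).
by have /(_ (asboolT q'q))/(congr1 sval) := qmin (exist _ q' (conj sq' q'p)).
Qed.

Theorem hahn_banach p : sublinear p -> exists phi : V -> R,
  [/\ {morph phi : x y / x + y}, (forall a x, phi (rc a *: x) = a * phi x) &
    forall x, phi x <= p x].
Proof.
move=> /min_sublinear[q [sq qp qmin]]; exists q.
have [qD qZ] := sq; have q0 := sublinear0 sq.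
have add u v : q (u + v) = q u + q v.
  apply/eqP; rewrite eq_le qD /=.
  pose g (t : R) x := q (x + rc t *: v) - t * q v.
  have qt t : 0 <= t -> q (rc t *: v) = t * q v.
    rewrite le_eqVlt => /predU1P[<-|t0]; first by rewrite rc0 scale0r q0 mul0r.
    apply/eqP; rewrite eq_le qZ//= -ler_pdivlMl//.
    have := qZ t^-1 (rc t *: v); rewrite scalerA -rcM mulVf ?gt_eqF// rc1 scale1r.
    by apply; rewrite invr_gt0.
  have lb t x : [set t | 0 <= t] t -> - q (- x) <= g t x.
    rewrite /g /= => t0; have := qD (x + rc t *: v) (- x).
    rewrite addrAC subrr add0r qt//; lra.
  have sg : sublinear (fun x => inf [set g t x | t in [set t | 0 <= t]]).
    apply: (sublinear_inf _ lb).
    - by exists 0 => /=.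
    - move=> s t x y /= s0 t0; exists (s + t); first exact: addr_ge0.
      rewrite /g rcD scalerDl addrACA mulrDl.
      have := qD (x + rc s *: v) (y + rc t *: v); lra.
    - move=> s t x /= s0 t0; exists (t * s); first by rewrite /= mulr_ge0// ltW.
      rewrite /g rcM -scalerA -scalerDr mulrBr mulrA lerD2r; exact: qZ.
  have gle t x : 0 <= t -> inf [set g t x | t in [set t | 0 <= t]] <= g t x.
    by move=> t0; apply: (@inf_leP _ (- q (- x))) => [_ [s /= s0 <-]|]; [exact: lb|exists t].
  (* The term at [t = 0] bounds the infimum by [q], so minimality makes them equal; the term at
     [t = 1] then gives [q u + q v <= q (u + v)]. *)
  have gE : (fun x => inf [set g t x | t in [set t | 0 <= t]]) = q.
    apply: qmin => // x; apply: le_trans (gle 0 x (lexx _)) _.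
    by rewrite /g rc0 scale0r addr0 mul0r subr0.
  have := gle 1 u ler01.
  rewrite -[X in X <= _ -> _]/((fun x => inf [set g t x | t in [set t | 0 <= t]]) u).
  by rewrite gE /g rc1 scale1r mul1r lerBrDr.
have qN x : q (- x) = - q x by have := add x (- x); rewrite subrr q0; lra.
split => // a x.
have pos b y : 0 < b -> q (rc b *: y) = b * q y.
  move=> b0; apply/eqP; rewrite eq_le qZ//=.
  by have := qZ b (- y) b0; rewrite scalerN !qN mulrN lerN2.
have [a0|a0|->] := ltgtP a 0; last by rewrite rc0 scale0r q0 mul0r.
  by have := pos (- a) x; rewrite rcN scaleNr qN mulNr oppr_gt0 => /(_ a0)/oppr_inj.
exact: pos.
Qed.
End hahn_banach.

(** * Ekeland's variational principle for a distance function *)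

Section ekeland.
Variables (R : realType) (k : scalar_kind).
Local Notation K := (scalars R k).
Local Notation rc := (@of_real R k).
Variable E : normedModType K.
Hypothesis bE : banach E.
Variable C : set E.
Hypothesis closedC : closed C.

(** Each step moves to a point of [S c] where [f] nearly attains its infimum over [S c], so the
    nested sets [S (z n)] shrink to a limit [l]. A [c] violating the inequality at [l] would lie in
    all of them, forcing [f l <= f c]. *)
Lemma ekeland (c0 p : E) (e : R) : C c0 -> 0 < e ->
  exists2 z, C z & forall c, C c -> rnorm (z - p) <= rnorm (c - p) + e * rnorm (c - z).
Proof.
move=> Cc0 e0; pose f c := rnorm (c - p).
pose S c := [set c' | C c' /\ f c' + e * rnorm (c' - c) <= f c].
have S_refl c : C c -> S c c by move=> Cc; split => //; rewrite subrr rnorm0 mulr0 addr0.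
have S_trans a b c : S a b -> S b c -> S a c.
  move=> [_ h1] [Cc h2]; split => //; have := rdistD b c a => h3.
  have : e * rnorm (c - a) <= e * (rnorm (c - b) + rnorm (b - a)) by rewrite ler_pM2l.
  rewrite mulrDr; lra.
have lbS c : lbound [set f c' | c' in S c] 0 by move=> _ [c' _ <-]; exact: rnorm_ge0.
pose m c := inf [set f c' | c' in S c].
have m_le c c' : S c c' -> m c <= f c' by move=> Sc; apply: inf_leP (lbS c) _; exists c'.
have step (nc : nat * E) : exists c', C nc.2 -> S nc.2 c' /\ f c' <= m nc.2 + nc.1.+1%:R^-1.
  case: nc => n c /=; have [Cc|nC] := pselect (C c); last by exists c.
  have [||_ [c' Sc' <-] lt] := @inf_adherent R [set f c' | c' in S c] n.+1%:R^-1.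
  - by rewrite invr_gt0.
  - by split; [exists (f c), c => //; exact: S_refl|exists 0].
  by exists c' => _; split => //; exact: ltW.
have /choice[next nextP] := step.
pose z := fix z n := if n is n'.+1 then next (n', z n') else c0.
have Cz n : C (z n).
  by elim: n => //= n Cn; have [[]] := nextP (n, z n) Cn.
have zS n : S (z n) (z n.+1) by have [] := nextP (n, z n) (Cz n).
have zm n : f (z n.+1) <= m (z n) + n.+1%:R^-1 by have [] := nextP (n, z n) (Cz n).
have zz n d : S (z n) (z (n + d)%N).
  elim: d => [|d IHd]; first by rewrite addn0; exact: S_refl.
  by rewrite addnS; apply: S_trans IHd (zS _).
have [||l zl] := @banach_seq _ _ _ bE (fun n => z n.+1) (fun n => e^-1 * n.+1%:R^-1).
- by rewrite -(mulr0 e^-1); apply: cvgMr; exact: cvg_harmonic.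
- move=> n j nj; rewrite ler_pdivlMl// rdistC.
  have [_ h1] := zz n.+1 (j - n)%N; rewrite addSn subnKC// in h1.
  have h2 := m_le _ _ (zz n (j.+1 - n)%N); rewrite subnKC ?(leq_trans nj)// in h2.
  by have := zm n; move: (n.+1%:R^-1) => t; lra.
have zl' d : 0 < d -> exists N, forall n, (N <= n)%N -> rnorm (l - z n.+1) < d.
  by move: zl => /cvg_rnormP zl /zl[N _ hN]; exists N => n /hN.
have flip (u v : E) : f u <= f v + rnorm (u - v).
  by rewrite addrC; exact: rdistD.
have Sl n : S (z n) l.
  split.
    by apply: (closed_cvg C closedC _ l zl); apply: nearW => j; exact: Cz.
  apply/ler_addgt0Pr => d d0.
  have d'0 : 0 < d / (1 + e) by rewrite divr_gt0// addr_gt0.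
  have [N hN] := zl' _ d'0; have := hN (n + N)%N (leq_addl _ _).
  rewrite ltr_pdivlMr ?addr_gt0// => h1.
  have [_ h2] := zz n N.+1; rewrite addnS in h2.
  have h3 := flip l (z (n + N).+1); have h4 := rdistD (z (n + N).+1) l (z n).
  have : e * rnorm (l - z n) <= e * (rnorm (l - z (n + N).+1) + rnorm (z (n + N).+1 - z n)).
    by rewrite ler_pM2l.
  move: h1; rewrite !mulrDr; lra.
exists l; first by have [] := Sl 0%N.
move=> c Cc; rewrite leNgt; apply/negP => lt.
have Slc : S l c by split => //; exact: ltW.
have : f l <= f c.
  apply/ler_addgt0Pr => d d0.
  have /cvgrPdist_lt/(_ d d0)[N _ hN] := @cvg_harmonic R.
  have := hN N (leqnn N); rewrite sub0r normrN ger0_norm ?invr_ge0//.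
  move=> hd'; have hd : N.+1%:R^-1 < d by exact: hd'.
  have := zm N; have := m_le _ _ (S_trans _ _ _ (Sl N) Slc).
  have [_] := Sl N.+1; have := rnorm_ge0 (l - z N.+1).
  move=> /(mulr_ge0 (ltW e0)); move: hd {hd'}; move: (N.+1%:R^-1) => t; lra.
have := mulr_ge0 (ltW e0) (rnorm_ge0 (c - l)); move: lt; rewrite /f; lra.
Qed.
End ekeland.

Section support_points.
Variables (R : realType) (k : scalar_kind).
Local Notation K := (scalars R k).
Local Notation rc := (@of_real R k).
Local Notation re := (@real_part R k).
Variable E : normedModType K.

Lemma bounded_complexify (phi : E -> R) (M : R) : {morph phi : x y / x + y} ->
  (forall a x, phi (rc a *: x) = a * phi x) -> (forall x, phi x <= M * rnorm x) ->
  exists f : dual E, forall x, re (f x) = phi x.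
Proof.
move=> phiD phiZ phiM; have [f [lf fE]] := complexify phiD phiZ.
have [|x|g gE] := @mk_operator R k E K^o f M; first exact: lf.
  have [u u1 uE] := rotate (f x).
  have fu : f (u *: x) = u * f x.
    have f0 : f 0 = 0.
      have /eqP := lf 1 0 0; rewrite scaler0 mul1r addr0 -subr_eq subrr.
      by rewrite eq_sym => /eqP.
    by have := lf u x 0; rewrite f0 !addr0.
  have -> : rnorm (f x : K^o) = phi (u *: x) by rewrite -fE fu uE.
  apply: le_trans (phiM _) _; rewrite rnormZ u1.
  by rewrite -(rc1 R k) rcK mul1r.
by exists g => x; rewrite gE fE.
Qed.

(** [C] may have empty interior, so a boundary point need not be supported; [ekeland] selects one
    that is. The slope [e = 1/2] is below 1, which makes [phi (p - z) <= (e - 1) * rnorm (z - p)]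
    negative and hence [f] non-zero. *)
Lemma support_point (C : set E) (p c0 : E) : banach E -> closed C ->
  (forall a b c d, 0 < a -> 0 < b -> a + b = 1 -> C c -> C d ->
    C (rc a *: c + rc b *: d)) ->
  C c0 -> ~ C p ->
  exists z (f : dual E), [/\ C z, f <> 0 & forall c, C c -> re (f c) <= re (f z)].
Proof.
move=> bE cC convC Cc0 nCp; have e0 : 0 < (2 : R)^-1 by rewrite invr_gt0.
have [z Cz hz] := ekeland bE cC p Cc0 e0; set e : R := 2^-1 in e0 hz.
pose D := [set tc : R * E | 0 < tc.1 /\ C tc.2].
(* A linear [phi] below the infimum of the [g tc], which is finite by [hz],
   satisfies [phi (z - c) <= 0] for [c] in [C] and [phi (p - z) < 0]. *)
pose g (tc : R * E) v := rnorm (v + rc tc.1 *: (tc.2 - p)) +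
  e * rnorm (v + rc tc.1 *: (tc.2 - z)) - tc.1 * rnorm (z - p).
have lb tc v : D tc -> - ((1 + e) * rnorm v) <= g tc v.
  case: tc => t c [/= t0 Cc]; rewrite /g /=.
  have rev (w : E) : t * rnorm w - rnorm v <= rnorm (v + rc t *: w).
    have <- : rnorm (rc t *: w) = t * rnorm w by rewrite rnormZr gtr0_norm.
    rewrite lerBlDr.
    by have := rnormD (v + rc t *: w) (- v); rewrite rnormN addrAC subrr add0r.
  have h1 := rev (c - p); have h2 := rev (c - z); have h3 := hz c Cc.
  have h4 := ler_wpM2l (ltW e0) h2; have h5 := ler_wpM2l (ltW t0) h3.
  move: h4 h5; rewrite mulrBr mulrDr mulrDl mul1r (mulrCA e t) opprD; lra.
have sP : sublinear (fun v => inf [set g tc v | tc in D]).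
  apply: (sublinear_inf _ lb); first by exists (1, z); split.
    move=> [s c] [t d] x y [/= s0 Cc] [/= t0 Cd]; have st : 0 < s + t by exact: addr_gt0.
    pose b := rc (s / (s + t)) *: c + rc (t / (s + t)) *: d.
    have Cb : C b.
      by apply: convC; rewrite ?divr_gt0// -mulrDl divff// gt_eqF.
    have scale_b w : rc (s + t) *: (b - w) = rc s *: (c - w) + rc t *: (d - w).
      rewrite !scalerBr addrACA -opprD -scalerDl -rcD; congr (_ - _).
      by rewrite scalerDr !scalerA -!rcM ![(s + t) * _]mulrC !divfK ?gt_eqF.
    exists (s + t, b) => //; rewrite /g /= !scale_b mulrDl.
    have h1 := rnormD (x + rc s *: (c - p)) (y + rc t *: (d - p)).
    have h2 := rnormD (x + rc s *: (c - z)) (y + rc t *: (d - z)).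
    rewrite addrACA in h1; rewrite addrACA in h2.
    have := ler_wpM2l (ltW e0) h2; rewrite mulrDr; move: h1; lra.
  move=> [s c] t x [/= s0 Cc] t0; exists (t * s, c); first by split => //=; rewrite mulr_gt0.
  rewrite /g /= !rcM -!scalerA -!scalerDr !rnormZr !(gtr0_norm t0).
  by rewrite le_eqVlt; apply/predU1P; left; ring.
have gle tc v : D tc -> inf [set g tc v | tc in D] <= g tc v.
  by move=> Dtc; apply: (@inf_leP _ _ (- ((1 + e) * rnorm v))) => [_ [s Ds <-]|];
    [exact: lb|exists tc].
have [phi [phiD phiZ phiP]] := hahn_banach sP.
have phi_le c v : C c ->
    phi v <= rnorm (v + (c - p)) + e * rnorm (v + (c - z)) - rnorm (z - p).
  move=> Cc; apply: le_trans (phiP v) _.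
  have Dc : D (1, c) by split => /=.
  by apply: le_trans (gle _ v Dc) _; rewrite /g /= rc1 !scale1r mul1r.
have phiN v : phi (- v) = - phi v.
  by have := phiZ (-1) v; rewrite rcN rc1 scaleN1r mulN1r.
have [|f fE] := @bounded_complexify phi (1 + e) phiD phiZ.
  move=> v; apply: le_trans (phi_le z v Cz) _; rewrite subrr addr0.
  have := rnormD v (z - p); rewrite mulrDl mul1r; lra.
exists z, (- f); split => //.
  move=> f0; have f00 : f = 0 by apply/eqP; rewrite -oppr_eq0 f0.
  have : 0 < rnorm (z - p).
    by rewrite rnorm_gt0 subr_eq0; apply/eqP => zp; apply: nCp; rewrite -zp.
  have := phi_le z (p - z) Cz; rewrite -fE f00.
  have -> : (0 : dual E) (p - z) = 0 by [].
  rewrite re0 addrA subrK subrr rnorm0 add0r subrr addr0 rdistC.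
  by rewrite /e; lra.
move=> c Cc; rewrite -[(- f) c]/(- f c) -[(- f) z]/(- f z) !reN !fE lerN2.
have := phi_le c (z - c) Cc; rewrite addrA subrK addrA subrK subrr rnorm0 mulr0 addr0 subrr.
by rewrite phiD phiN subr_le0.
Qed.
End support_points.

(** * Resolving vector functionals *)

Section real_functionals.
Variables (R : realType) (k : scalar_kind).
Local Notation K := (scalars R k).
Local Notation rc := (@of_real R k).
Local Notation re := (@real_part R k).
Variable X : normedModType K.
Implicit Types w : {ptws X -> R}.

Definition real_linear w :=
  (forall x y, w (x + y) = w x + w y) /\ (forall a x, w (rc a *: x) = a * w x).

Lemma real_linear_re (y : dual X) : real_linear (fun x => re (y x)).
Proof.
split => [u v|a x]; first by rewrite (opD y) reD.
by rewrite (opZ y) -re_rcM.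
Qed.

Lemma real_linearB w w' : real_linear w -> real_linear w' ->
  real_linear (fun x => w x - w' x).
Proof.
move=> [wD wZ] [wD' wZ']; split => [x y|a x].
  by rewrite wD wD' opprD addrACA.
by rewrite wZ wZ' mulrBr.
Qed.

Lemma real_linear_bound w (M : R) : real_linear w ->
  (forall x, rnorm x <= 1 -> `|w x| <= M) -> forall x, `|w x| <= M * rnorm x.
Proof.
move=> [wD wZ] wM x; have [->|x0] := eqVneq x 0.
  have := wZ 0 0; rewrite scaler0 mul0r => ->.
  by rewrite normr0 rnorm0 mulr0.
have nx : 0 < rnorm x by rewrite rnorm_gt0.
have := wM (rc (rnorm x)^-1 *: x); rewrite rnormZr wZ normrM gtr0_norm ?invr_gt0//.
by rewrite mulVf ?gt_eqF// => /(_ (lexx _)); rewrite ler_pdivrMl// mulrC.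
Qed.

Lemma re_op_le (y : dual X) v : `|re (y v)| <= rnorm y * rnorm v.
Proof. by apply: le_trans (re_norm_ge _) _; exact: op_rnorm. Qed.

Lemma op_rnorm_re (y : dual X) (M : R) : 0 <= M ->
  (forall v, rnorm v <= 1 -> re (y v) <= M) -> rnorm y <= M.
Proof.
move=> M0 h; apply: op_rnorm_le => // v v1; have [u u1 uE] := rotate (y v).
have -> : rnorm (y v) = re (y (u *: v)) by rewrite (opZ y) [_ *: _]uE.
apply: h; rewrite rnormZ u1.
by rewrite -(rc1 R k) rcK mul1r.
Qed.

End real_functionals.

(** * Lomonosov's fixed point argument *)

Section lomonosov.
Variables (R : realType) (k : scalar_kind).
Local Notation K := (scalars R k).
Local Notation rc := (@of_real R k).
Local Notation re := (@real_part R k).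
Variable X : normedModType K.
Variables (A : set (endo X)) (y0 : dual X).
Hypothesis algA : operator_algebra A.
Hypothesis y02 : rnorm y0 = 2.
Hypothesis dense : forall y : dual X, y <> 0 -> exists T C : endo X,
  [/\ A T, compact_operator C, rnorm (T - C) <= 8^-1 &
      rnorm (adjoint T y - y0) <= 4^-1].

(* The real parts of the functionals in the closed unit ball around [y0], where
   the weak-star topology is that of pointwise convergence. *)
Let ball0 : set {ptws X -> R} :=
  [set w | real_linear w /\ forall v, `|w v - re (y0 v)| <= rnorm v].

Let eval_cvg (F : set_system {ptws X -> R}) (w : {ptws X -> R}) v : Filter F ->
  F --> w -> (fun u : {ptws X -> R} => u v) @ F --> w v.
Proof.
move=> FF Fw; apply: (cvg_comp id (fun u : {ptws X -> R} => u v) Fw).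
by have /(_ w) := @proj_continuous X (fun=> R) v.
Qed.

Let compact_ball0 : compact ball0.
Proof.
rewrite compact_ultra => U UU Ub.
pose B v := `[re (y0 v) - rnorm v, re (y0 v) + rnorm v]%classic.
have cB : compact [set w : {ptws X -> R} | forall v, B v (w v)].
  by apply: (@tychonoff X (fun=> R)) => v; exact: segment_compact.
have UB : U [set w : {ptws X -> R} | forall v, B v (w v)].
  apply: filterS Ub => w [_ hw] v; have := hw v.
  by rewrite /B /= in_itv /= ler_distl.
have [w [Bw Uw]] : [set w : {ptws X -> R} | forall v, B v (w v)] `&` [set w | U --> w] !=set0.
  by move: cB; rewrite compact_ultra; apply.
have ev v : (fun u : {ptws X -> R} => u v) @ U --> w v by apply: eval_cvg.
exists w; split => //; split.
  split => [x y|a x].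
    have h1 : (fun u : {ptws X -> R} => u x + u y) @ U --> w x + w y by apply: cvgD.
    have h2 : (fun u : {ptws X -> R} => u x + u y) @ U --> w (x + y).
      apply: cvg_trans (ev (x + y)); apply: near_eq_cvg.
      by apply: filterS Ub => u [[uD _] _] /=; rewrite uD.
    exact: (cvg_unique _ h2 h1).
  have h1 : (fun u : {ptws X -> R} => a * u x) @ U --> a * w x by apply: cvgMr.
  have h2 : (fun u : {ptws X -> R} => a * u x) @ U --> w (rc a *: x).
    apply: cvg_trans (ev (rc a *: x)); apply: near_eq_cvg.
    by apply: filterS Ub => u [[_ uZ] _] /=; rewrite uZ.
  exact: (cvg_unique _ h2 h1).
by move=> v; have := Bw v; rewrite /B /= in_itv /= ler_distl.
Qed.

Let lip w w' v : ball0 w -> ball0 w' -> `|w v - w' v| <= 2 * rnorm v.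
Proof.
move=> [_ hw] [_ hw']; apply: le_trans (ler_distD (re (y0 v)) _ _) _.
by have := hw v; have := hw' v; rewrite (distrC (w' v)); lra.
Qed.

Let lift_functional w : ball0 w ->
  exists2 y : dual X, y <> 0 & forall v, re (y v) = w v.
Proof.
move=> [[wD wZ] hw]; have [|y yE] := @bounded_complexify R k X w (rnorm y0 + 1) wD wZ.
  move=> v; have := hw v; rewrite ler_norml => /andP[_ h].
  by have := le_trans (ler_norm _) (re_op_le y0 v); rewrite mulrDl mul1r; lra.
exists y => // yz; suff : rnorm (y0 - y) <= 1 by rewrite yz subr0 y02; lra.
apply: op_rnorm_re => // v v1.
rewrite -[(y0 - y) v]/(y0 v - y v) reB yE.
by apply: le_trans (ler_norm _) _; rewrite distrC; apply: le_trans v1.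
Qed.

Lemma lomonosov_fixed_point : exists T S C : endo X, exists y : dual X,
  [/\ A T, T = S + C, rnorm S <= 8^-1, compact_operator C &
      y <> 0 /\ forall x, y (T x) = y x].
Proof.
have /choice[T0 hT0] w : exists T : endo X, ball0 w -> exists C : endo X,
    exists2 y : dual X, forall v, re (y v) = w v &
    [/\ A T, compact_operator C, rnorm (T - C) <= 8^-1 &
      rnorm (adjoint T y - y0) <= 4^-1].
  have [bw|nb] := pselect (ball0 w); last by exists 0.
  have [y y0' yE] := lift_functional bw; have [T [C h]] := dense y0'.
  by exists T => _; exists C, y.
have /choice[C0 hC0] w : exists C : endo X, ball0 w ->
    exists2 y : dual X, forall v, re (y v) = w v &
    [/\ A (T0 w), compact_operator C, rnorm (T0 w - C) <= 8^-1 &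
      rnorm (adjoint (T0 w) y - y0) <= 4^-1].
  have [bw|nb] := pselect (ball0 w); last by exists 0.
  by have [C h] := hT0 w bw; exists C.
pose E (C : endo X) (w w' : {ptws X -> R}) :=
  [set `|w (C v) - w' (C v)| | v in [set v : X | rnorm v <= 1]].
(* The norm of the adjoint of [C] at [w - w'], read on real parts; [q_cvg] is the weak-star to norm
   continuity of this adjoint on [ball0]. *)
pose q (C : endo X) (w w' : {ptws X -> R}) := sup (E C w w').
have hasE (C : endo X) (w w' : {ptws X -> R}) : ball0 w -> ball0 w' -> has_sup (E C w w').
  move=> bw bw'; split; first by exists `|w (C 0) - w' (C 0)|, 0 => //=; rewrite rnorm0.
  exists (2 * rnorm C) => _ [v /= v1 <-]; apply: le_trans (lip _ bw bw') _.
  by rewrite ler_pM2l//; exact: op_rnorm_le1.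
have le_q (C : endo X) (w w' : {ptws X -> R}) v : ball0 w -> ball0 w' -> rnorm v <= 1 ->
    `|w (C v) - w' (C v)| <= q C w w'.
  move=> bw bw' v1; apply: sup_upper_bound; first exact: hasE.
  by exists v.
have q_le (C : endo X) (w w' : {ptws X -> R}) e :
    (forall v, rnorm v <= 1 -> `|w (C v) - w' (C v)| <= e) -> q C w w' <= e.
  move=> h; apply: ge_sup; first by exists `|w (C 0) - w' (C 0)|, 0 => //=; rewrite rnorm0.
  by move=> _ [v /= v1 <-]; exact: h.
have q_cvg (C : endo X) (w w0 : {ptws X -> R}) : compact_operator C -> ball0 w -> ball0 w0 ->
    q C w' w @[w' --> within ball0 (nbhs w0)] --> q C w0 w.
  move=> cC bw bw0; apply/cvgrPdist_le => e e0.
  have inb : \forall w' \near within ball0 (nbhs w0), ball0 w' by exact: withinT.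
  have near_le : \forall w' \near within ball0 (nbhs w0), forall v, rnorm v <= 1 ->
      `|w' (C v) - w0 (C v)| <= e.
    apply: (@compact_unif R k X C _ (within ball0 (nbhs w0))
      (fun w' u => `|w' u - w0 u|) 2 cC) e0.
      apply: filterS inb => w' bw' u v.
      have [[[wD' _] _] [[wD0 _] _]] := (bw', bw0).
      have -> : w' u - w0 u = (w' v - w0 v) + (w' (u - v) - w0 (u - v)).
        by rewrite addrACA -wD' -opprD -wD0 [v + _]addrC subrK.
      by apply: le_trans (ler_normD _ _) _; rewrite lerD2l lip.
    move=> u d d0; have : (fun w' : {ptws X -> R} => w' u) @ within ball0 (nbhs w0) --> w0 u.
      by apply: cvg_within_filter; apply: (@eval_cvg (nbhs w0)).
    move=> /cvgrPdist_le/(_ d d0); apply: filterS => w'.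
    by rewrite distrC.
  have FG : Filter (within ball0 (nbhs w0)) by exact: within_filter.
  have := @filterI _ (within ball0 (nbhs w0)) FG _ _ near_le inb.
  apply: (@filterS _ (within ball0 (nbhs w0))) => w' [h bw'].
  rewrite ler_distl; apply/andP; split.
    rewrite lerBlDr; apply: q_le => v v1.
    apply: le_trans (ler_distD (w0 (C v)) _ _) _; rewrite addrC lerD ?h//.
    exact: le_q.
  apply: q_le => v v1.
  apply: le_trans (ler_distD (w' (C v)) _ _) _; rewrite addrC lerD ?le_q//.
  by rewrite distrC h.
(* Continuity of [q] holds within [ball0] only; the premise [ball0 w'] in the cover yields
   neighbourhoods in the whole product. *)
have [s sb cov] : exists2 s : seq {ptws X -> R}, (forall w, w \in s -> ball0 w) &
    forall w', ball0 w' -> exists2 w, w \in s & ball0 w' -> q (C0 w) w' w < 4^-1.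
  apply: (compact_finite_subcover compact_ball0
    (U := fun w => [set w' | ball0 w' -> q (C0 w) w' w < 4^-1])) => w bw.
  have [y yE [_ cC _ _]] := hC0 w bw.
  have := q_cvg _ _ _ cC bw bw; move=> /cvgr_lt; apply.
  apply: (@le_lt_trans _ _ 0); last by rewrite invr_gt0.
  by apply: q_le => v v1; rewrite subrr normr0.
pose b w w' := `|4^-1 - q (C0 w) w' w| + (4^-1 - q (C0 w) w' w).
have b_ge0 w w' : 0 <= b w w' by rewrite /b -lerBlDr sub0r -normrN ler_norm.
pose B w' := \sum_(w <- s) b w w'.
have B_gt0 w' : ball0 w' -> 0 < B w'.
  move=> bw'; have [w ws /(_ bw') lt] := cov w' bw'.
  rewrite /B (big_rem w)//= ltr_pwDl ?sumr_ge0//.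
  by rewrite addr_gt0 ?normr_gt0 ?subr_gt0// subr_eq0 gt_eqF.
pose Psi (w' : {ptws X -> R}) : {ptws X -> R} :=
  fun v => \sum_(w <- s) b w w' / B w' * w' (T0 w v).
have sumb w' : ball0 w' -> \sum_(w <- s) b w w' / B w' = 1.
  by move=> bw'; rewrite -mulr_suml divff// gt_eqF// B_gt0.
have bB_ge0 w w' : ball0 w' -> 0 <= b w w' / B w'.
  by move=> bw'; rewrite divr_ge0// ltW// B_gt0.
(* Three errors of at most 1/4: [w' - w] at [C0 w v], by the cover; [w' - w] at [(T0 w - C0 w) v],
   at most [2 * 8^-1] by [lip]; and the distance to [y0] granted by [dense]. *)
have close w w' v : w \in s -> ball0 w' -> b w w' != 0 -> rnorm v <= 1 ->
    `|w' (T0 w v) - re (y0 v)| <= 1.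
  move=> ws bw' nb v1; have bw := sb w ws; have [y yE [_ _ TC Ty]] := hC0 w bw.
  have lt : q (C0 w) w' w < 4^-1.
    rewrite ltNge; apply: contra nb => le; rewrite /b ler0_norm ?subr_le0//.
    by rewrite addNr.
  have h1 : `|w (T0 w v) - re (y0 v)| <= 4^-1.
    rewrite -yE -reB; apply: le_trans (re_norm_ge _) _.
    by apply: le_trans Ty; apply: (@op_rnorm_le1 _ _ _ _ (adjoint (T0 w) y - y0)).
  have h2 : `|w' (C0 w v) - w (C0 w v)| <= 4^-1.
    by apply: le_trans (ltW lt); exact: le_q.
  have h3 : `|w' ((T0 w - C0 w) v) - w ((T0 w - C0 w) v)| <= 4^-1.
    apply: le_trans (lip _ bw' bw) _.
    have : rnorm ((T0 w - C0 w) v) <= 8^-1.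
      by apply: le_trans TC; exact: op_rnorm_le1.
    lra.
  have Tv : T0 w v = C0 w v + (T0 w - C0 w) v.
    by rewrite -[(T0 w - C0 w) v]/(T0 w v - C0 w v) addrC subrK.
  have [[[wD _] _] [[wD' _] _]] := (bw, bw').
  have -> : w' (T0 w v) - re (y0 v) = (w' (C0 w v) - w (C0 w v)) +
      (w' ((T0 w - C0 w) v) - w ((T0 w - C0 w) v)) + (w (T0 w v) - re (y0 v)).
    have e1 : w' (T0 w v) = w' (C0 w v) + w' ((T0 w - C0 w) v) by rewrite {1}Tv wD'.
    have e2 : w (T0 w v) = w (C0 w v) + w ((T0 w - C0 w) v) by rewrite {1}Tv wD.
    by rewrite e1 e2; ring.
  apply: le_trans (ler_normD _ _) _; have := ler_normD (w' (C0 w v) - w (C0 w v))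
     (w' ((T0 w - C0 w) v) - w ((T0 w - C0 w) v)).
  lra.
have Psi_ball w' : ball0 w' -> ball0 (Psi w').
  move=> bw'; have [[wD' wZ'] _] := bw'.
  have rl : real_linear (Psi w').
    split => [x y|a x]; rewrite /Psi.
      rewrite -big_split; apply: eq_bigr => w _ /=.
      by rewrite (opD (T0 w)) wD' mulrDr.
    rewrite mulr_sumr; apply: eq_bigr => w _.
    by rewrite (opZ (T0 w)) wZ' mulrCA.
  split => // v; rewrite -[leRHS]mul1r.
  apply: (real_linear_bound (real_linearB rl (real_linear_re y0))) => {}v v1.
  have -> : Psi w' v - re (y0 v) = \sum_(w <- s) b w w' / B w' * (w' (T0 w v) - re (y0 v)).
    under [RHS]eq_bigr do rewrite mulrBr.
    by rewrite sumrB -mulr_suml sumb// mul1r.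
  apply: le_trans (ler_norm_sum _ _ _) _; rewrite -(sumb w' bw').
  rewrite big_seq [leRHS]big_seq; apply: ler_sum => w ws.
  rewrite normrM ger0_norm ?bB_ge0//.
  have [->|nb] := eqVneq (b w w') 0; first by rewrite !mul0r.
  by rewrite -[leRHS]mulr1 ler_wpM2l ?bB_ge0// close.
have [||||w bw Pw] := @schauder_tychonoff R X ball0 Psi compact_ball0.
- exists (fun v => re (y0 v)); split; first exact: real_linear_re.
  by move=> v; rewrite subrr normr0 rnorm_ge0.
- move=> n l z [l0 l1] zb; split.
    split => [x y|a x].
      rewrite -big_split; apply: eq_bigr => i _ /=.
      by have [[zD _] _] := zb i; rewrite zD mulrDr.
    rewrite mulr_sumr; apply: eq_bigr => i _.
    by have [[_ zZ] _] := zb i; rewrite zZ mulrCA.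
  move=> v; have -> : \sum_i l 0 i * z i v - re (y0 v) = \sum_i l 0 i * (z i v - re (y0 v)).
    under [RHS]eq_bigr do rewrite mulrBr.
    by rewrite sumrB -mulr_suml l1 mul1r.
  apply: le_trans (ler_norm_sum _ _ _) _.
  rewrite -[leRHS]mul1r -l1 mulr_suml; apply: ler_sum => i _.
  by rewrite normrM ger0_norm// ler_wpM2l//; have [_] := zb i.
- exact: Psi_ball.
- move=> w' v bw'; set G := within _ _.
  have ev u : (fun w : {ptws X -> R} => w u) @ G --> w' u.
    by rewrite /G; apply: cvg_within_filter; apply: (@eval_cvg (nbhs w')).
  have b_cvg w : w \in s -> b w w'' @[w'' --> G] --> b w w'.
    move=> ws; have bw := sb w ws; have [y yE [_ cC _ _]] := hC0 w bw.
    have tc : 4^-1 - q (C0 w) w'' w @[w'' --> G] --> 4^-1 - q (C0 w) w' w.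
      by apply: cvgB; [exact: cvg_cst|exact: q_cvg].
    by apply: cvgD => //; exact: cvg_norm.
  apply: cvg_sum => w ws; apply: cvgM; last exact: ev.
  apply: cvgM; first exact: b_cvg.
  by apply: cvgV; [rewrite gt_eqF// B_gt0|exact: cvg_sum].
have [y y_neq0 yE] := lift_functional bw.
(* Freezing the weights at the fixed point [w] turns the nonlinear map [Psi] into the adjoint of one
   operator of [A]. *)
pose l v := b v w / B w.
have l_ge0 v : 0 <= l v by exact: bB_ge0.
pose T := \sum_(v <- s) rc (l v) *: T0 v; pose C := \sum_(v <- s) rc (l v) *: C0 v.
have TE x : T x = \sum_(v <- s) rc (l v) *: T0 v x.
  rewrite /T; elim: (s) => [|v s' IHs]; first by rewrite !big_nil.
  by rewrite !big_cons -IHs.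
exists T, (T - C), C, y; split.
- have [A0 lA _] := algA; rewrite /T big_seq; apply: big_rec => // v U vs AU.
  by apply: lA => //; have [y' _ [AT _ _ _]] := hC0 v (sb v vs).
- by rewrite subrK.
- have -> : T - C = \sum_(v <- s) rc (l v) *: (T0 v - C0 v).
    by rewrite -sumrB; apply: eq_bigr => v _; rewrite scalerBr.
  have -> : 8^-1 = \sum_(v <- s) l v * 8^-1 :> R by rewrite -mulr_suml sumb// mul1r.
  rewrite big_seq [leRHS]big_seq; elim/big_rec2: _ => [|v a U vs le]; first by rewrite rnorm0.
  apply: le_trans (rnormD _ _) _; apply: lerD => //.
  rewrite rnormZr ger0_norm// ler_wpM2l//.
  by have [y' _ [_ _ TC _]] := hC0 v (sb v vs).
- rewrite /C big_seq; apply: big_rec => [|v U vs cU]; first exact: compact_operator0.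
  apply: compact_operatorD => //; apply: compact_operatorZ.
  by have [y' _ [_ cC _ _]] := hC0 v (sb v vs).
split => // x; apply/eqP; rewrite -subr_eq0 -(opB y).
have re0' v : re (y (T v - v)) = 0.
  have [[wD wZ] _] := bw.
  have wsum v' (s' : seq {ptws X -> R}) :
      w (\sum_(v <- s') rc (l v) *: T0 v v') = \sum_(v <- s') l v * w (T0 v v').
    elim: s' => [|v1 s' IHs]; last by rewrite !big_cons wD wZ IHs.
    by rewrite !big_nil; have := wZ 0 0; rewrite scaler0 mul0r.
  by rewrite (opB y) reB !yE TE wsum -{2}Pw subrr.
have [u u1 uE] := rotate (y (T x - x)).
have : re (u * y (T x - x)) = 0.
  rewrite -[u * _]/(u *: (y (T x - x))) -(opZ y) scalerBr -(opZ T); exact: re0'.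
rewrite uE => h; rewrite -normr_eq0 (ge0_rc (normr_ge0 _)) h.
by rewrite rc0.
Qed.
End lomonosov.

(** * Essential orbits and the resolving pair *)

Section resolving.
Variables (R : realType) (k : scalar_kind).
Local Notation K := (scalars R k).
Local Notation rc := (@of_real R k).
Local Notation re := (@real_part R k).

Lemma re_norm_le_ge0 (a : K) : re `|a| <= re a -> 0 <= a.
Proof.
rewrite /real_part; case: k a => /= [a|[u v] /=]; first exact: le_trans.
move=> h; have u0 : 0 <= u by apply: le_trans h; exact: sqrtr_ge0.
rewrite lecE /= u0 andbT -sqrf_eq0 eq_le sqr_ge0 andbT.
have uv : 0 <= u ^+ 2 + v ^+ 2 by rewrite addr_ge0 ?sqr_ge0.
have := ler_pM (sqrtr_ge0 _) (sqrtr_ge0 _) h h.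
by rewrite -!expr2 sqr_sqrtr// gerDl.
Qed.

Lemma closure_rnormP (V : normedModType K) (G : set V) x :
  closure G x <-> forall e : R, 0 < e -> exists2 g, G g & rnorm (x - g) < e.
Proof.
split => [clx e e0|h N /nbhs_ballP[e /= e0 he]].
  have : (fun y : V => y) @ nbhs x --> x by exact: cvg_id.
  by move=> /cvg_rnormP/(_ e e0)/clx[g [Gg xg]]; exists g.
have eE := ge0_rc (ltW e0); have [|g Gg xg] := h (re e).
  by rewrite -(ltr_rc k) -eE rc0.
exists g; split => //; apply: he; rewrite -ball_normE /= -rnormE.
by move: xg; rewrite -(ltr_rc k) -eE.
Qed.

Variable X : completeNormedModType K.

Lemma essential_norm_ge0 (T : endo X) : 0 <= essential_norm T.
Proof. by have [_] := essential_normE T; apply => _ [C _ <-]. Qed.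

Lemma essential_norm_lt (T : endo X) (c : R) : re (essential_norm T) < c ->
  exists2 C, compact_operator C & rnorm (T - C) < c.
Proof.
move=> lt; apply: contrapT => nC; have [_ glb] := essential_normE T.
have : rc c <= essential_norm T.
  apply: glb => _ [C cC <-]; rewrite -rnormE ler_rc leNgt; apply/negP => h.
  apply: nC; exists (- C); last by rewrite opprK.
  by rewrite -scaleN1r; exact: compact_operatorZ.
by move=> /le_re; rewrite rcK leNgt lt.
Qed.

Variable A : set (endo X).
Hypothesis algA : operator_algebra A.

Definition essential_orbit (y : dual X) : set (dual X) :=
  [set g | exists T C,
    [/\ A T, compact_operator C, rnorm (T - C) < 1 & g = adjoint T y]].

Lemma adjointE (T : endo X) (y : dual X) x : adjoint T y x = y (T x).
Proof. by []. Qed.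

Lemma algebraZ a T : A T -> A (a *: T).
Proof. by have [A0 lA _] := algA; move=> AT; rewrite -[_ *: _]addr0; exact: lA. Qed.

Lemma essential_orbit_convex y : forall a b c d, 0 < a -> 0 < b -> a + b = 1 ->
  closure (essential_orbit y) c -> closure (essential_orbit y) d ->
  closure (essential_orbit y) (rc a *: c + rc b *: d).
Proof.
move=> a b c d a0 b0 ab1 /closure_rnormP hc /closure_rnormP hd.
apply/closure_rnormP => e e0.
have [_ [T [C [AT cC TC ->]] hT]] := hc e e0.
have [_ [T' [C' [AT' cC' TC' ->]] hT']] := hd e e0.
exists (adjoint (rc a *: T + rc b *: T') y).
  exists (rc a *: T + rc b *: T'), (rc a *: C + rc b *: C'); split => //.
  - by have [_ lA _] := algA; apply: lA => //; exact: algebraZ.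
  - by apply: compact_operatorD; exact: compact_operatorZ.
  - rewrite opprD addrACA -!scalerBr; apply: le_lt_trans (rnormD _ _) _.
    by rewrite !rnormZr !gtr0_norm// -ab1 ltrD// gtr_pMr.
have -> : adjoint (rc a *: T + rc b *: T') y = rc a *: adjoint T y + rc b *: adjoint T' y.
  by apply: op_eq => x; rewrite adjointE (opD y) !(opZ y).
rewrite opprD addrACA -!scalerBr; apply: le_lt_trans (rnormD _ _) _.
by rewrite !rnormZr !gtr0_norm// -[ltRHS]mul1r -ab1 mulrDl ltrD// ltr_pM2l.
Qed.

Lemma essential_orbit_mul y T (e : R) g : A T -> re (essential_norm T) < e ->
  essential_orbit y g -> essential_orbit y (rc e^-1 *: adjoint T g).
Proof.
move=> AT Te [U [D [AU cD UD ->]]].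
have e0 : 0 < e.
  by apply: le_lt_trans Te; rewrite -(re0 R k); apply: le_re; exact: essential_norm_ge0.
have [C cC TC] := essential_norm_lt Te.
(* The compact part is chosen so that what remains of [U T] is the product [(U - D) (T - C)], of
   norm below [e]. *)
exists (rc e^-1 *: comp_operator U T),
  (rc e^-1 *: (comp_operator (U - D) C + comp_operator D T)); split.
- by apply: algebraZ; have [_ _ mA] := algA; exact: mA.
- apply: compact_operatorZ; apply: compact_operatorD.
    exact: compact_compl.
  exact: compact_compr.
- rewrite -scalerBr rnormZr gtr0_norm ?invr_gt0// mulrC ltr_pdivrMr// mul1r.
  have -> : comp_operator U T - (comp_operator (U - D) C + comp_operator D T) =
      comp_operator (U - D) (T - C).
    apply: op_eq => x; rewrite -[RHS]/((U - D) (T x - C x)) (opB (U - D)).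
    rewrite -[LHS]/(U (T x) - ((U - D) (C x) + D (T x))).
    by rewrite opprD addrA addrAC.
  apply: le_lt_trans (comp_rnorm _ _) _; apply: le_lt_trans TC.
  by rewrite ler_piMl ?rnorm_ge0// ltW.
- by apply: op_eq => x; rewrite [RHS](opZ y).
Qed.

Lemma resolving_of_not_dense (y p : dual X) : y <> 0 ->
  ~ closure (essential_orbit y) p ->
  exists (x : dual (dual X)) (z : dual X), [/\ x <> 0, z <> 0 &
    forall T, A T -> `|x (adjoint T z)| <= essential_norm T * x z].
Proof.
move=> y0 np; have bD : banach (dual X) by apply: banach_op; exact: banach_scalars.
have G0 : closure (essential_orbit y) 0.
  apply: subset_closure; exists 0, 0; split.
  - by case: algA.
  - exact: compact_operator0.
  - by rewrite subr0 rnorm0.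
  - by apply: op_eq => x; apply/esym; exact: (linear0 y).
have [z [f [Gz f0 fz]]] :=
  support_point bD (@closed_closure _ _) (essential_orbit_convex (y := y)) G0 np.
set m := re (f z) in fz.
have orbit_le g : essential_orbit y g -> rnorm (f g : K^o) <= m.
  move=> [T [C [AT cC TC ->]]]; have [u u1 uE] := rotate (f (adjoint T y)).
  have -> : rnorm (f (adjoint T y) : K^o) = re (f (u *: adjoint T y)).
    by rewrite (opZ f) [_ *: _]uE.
  apply: fz; apply: subset_closure; exists (u *: T), (u *: C); split.
  - exact: algebraZ.
  - exact: compact_operatorZ.
  - by rewrite -scalerBr rnormZ u1 -(rc1 R k) rcK mul1r.
  - by apply: op_eq => x; rewrite [RHS](opZ y).
have closure_le (h : dual (dual X)) M :
    (forall g, essential_orbit y g -> rnorm (h g : K^o) <= M) ->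
    forall c, closure (essential_orbit y) c -> rnorm (h c : K^o) <= M.
  move=> hM c /closure_rnormP hc; apply/ler_addgt0Pr => e e0.
  have h1 : 0 < rnorm h + 1 by rewrite ltr_wpDl ?rnorm_ge0.
  have [g Gg cg] := hc _ (divr_gt0 e0 h1).
  have -> : h c = h g + h (c - g) by rewrite (opB h) addrC subrK.
  apply: le_trans (rnormD _ _) _; apply: lerD; first exact: hM.
  apply: le_trans (op_rnorm _ _) _; move: cg; rewrite ltr_pdivlMr// => /ltW; apply: le_trans.
  by rewrite mulrC ler_wpM2l ?rnorm_ge0// lerDl.
(* [z] lies in the closure itself, so the modulus of [f z] is at most its real part, and [f z] is a
   nonnegative real. *)
have fz_ge0 : 0 <= f z by apply: re_norm_le_ge0; exact: (closure_le f m orbit_le).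
have m_ge0 : 0 <= m by apply: le_trans (closure_le f m orbit_le z Gz); exact: rnorm_ge0.
have resolving T : A T -> `|f (adjoint T z)| <= essential_norm T * f z.
  move=> AT; rewrite (ge0_rc fz_ge0) (ge0_rc (essential_norm_ge0 T)) -rcM.
  rewrite -[X in X <= _](@rnormE R k K^o) ler_rc -/m.
  (* [z] need not be in the orbit, so the bound is proved on the orbit for the second adjoint of [T]
     at [f] and passed to the closure. *)
  apply: (closure_le (adjoint (adjoint T) f)) Gz => g Gg.
  rewrite -[adjoint (adjoint T) f g]/(f (adjoint T g)).
  apply/ler_addgt0Pr => e e0; set r := re _.
  have m1 : 0 < m + 1 by rewrite ltr_wpDl.
  have d0 : 0 < e / (m + 1) by rewrite divr_gt0.
  have rd : r < r + e / (m + 1) by rewrite ltrDl.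
  have rd0 : 0 < r + e / (m + 1).
    apply: le_lt_trans rd; rewrite -(re0 R k); apply: le_re; exact: essential_norm_ge0.
  have := orbit_le _ (essential_orbit_mul AT rd Gg).
  rewrite (opZ f) rnormZr gtr0_norm ?invr_gt0// ler_pdivrMl// => h.
  apply: le_trans h _; rewrite mulrDl lerD2l -mulrA ler_piMr ?(ltW e0)//.
  by rewrite mulrC ler_pdivrMr// mul1r lerDl.
have [z0|z0] := pselect (z = 0); last by exists f, z.
have m0 : m = 0 by rewrite /m z0 -(scale0r (0 : dual X)) (opZ f) scale0r re0.
(* [f] vanishes on the orbit as [m = 0], and every [T] in [A] enters the orbit after division by
   [rnorm T + 1]. The rotation below makes the value at [y] nonnegative, so that the right-hand side
   is too. *)
have f_orbit T : A T -> f (adjoint T y) = 0.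
  move=> AT; pose e := rnorm T + 1; have e0 : 0 < e by rewrite ltr_wpDl ?rnorm_ge0.
  have : essential_orbit y (rc e^-1 *: adjoint T y).
    exists (rc e^-1 *: T), 0; split.
    - exact: algebraZ.
    - exact: compact_operator0.
    - rewrite subr0 rnormZr gtr0_norm ?invr_gt0// mulrC ltr_pdivrMr// mul1r.
      by rewrite ltrDl.
    - by apply: op_eq => x; rewrite [RHS](opZ y).
  move=> /orbit_le; rewrite m0 (opZ f) rnormZr gtr0_norm ?invr_gt0//.
  rewrite pmulr_rle0 ?invr_gt0// => h; apply/eqP.
  by rewrite -(@rnorm_eq0 R k K^o) eq_le h rnorm_ge0.
have [u u1 uE] := rotate (f y).
exists (u *: f), y; split => //.
  move=> uf; apply: f0; have u0 : u != 0 by rewrite -normr_eq0 u1 oner_eq0.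
  by rewrite -(scalerK u0 f) uf scaler0.
move=> T AT; rewrite -[(u *: f) (adjoint T y)]/(u * f (adjoint T y)) f_orbit//.
rewrite mulr0 normr0 -[(u *: f) y]/(u * f y) uE.
by rewrite mulr_ge0// essential_norm_ge0.
Qed.

End resolving.

Theorem theorem1p3 (R : realType) (k : scalar_kind)
    (X : completeNormedModType (scalars R k)) (hX : exists v : X, v <> 0)
    (A : set (endo X)) (hA : operator_algebra A) (hcl : closed A)
    (hfr : forall T : endo X, A T -> finite_rank T -> T = 0) :
  exists (x : dual (dual X)) (y : dual X),
    [/\ x <> 0, y <> 0 &
      forall T : endo X, A T ->
        `|x (adjoint T y)| <= essential_norm T * x y].
Proof.
have [[y [p [y0 np]]]|dense] := pselect (exists y p : dual X, y <> 0 /\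
    ~ closure (essential_orbit A y) p).
  exact: (resolving_of_not_dense hA y0 np).
exfalso; have [v0 nv0] := hX.
(* Supporting the set [[set 0]], which misses [v0], yields a non-zero functional on [X]. *)
have [|||||z [f [_ f0 _]]] := @support_point R k X [set 0] v0 0.
- exact: banach_complete.
- by apply: compact_closed; [exact: norm_hausdorff|exact: compact_set1].
- by move=> a b c d _ _ _ -> ->; rewrite /= !scaler0 addr0.
- by [].
- by [].
have nf : 0 < rnorm f by rewrite rnorm_gt0; apply/eqP.
pose y0 := of_real k (2 / rnorm f) *: f.
have y02 : rnorm y0 = 2.
  by rewrite rnormZr gtr0_norm ?divr_gt0// divfK// gt_eqF.
have [|T [S [C [y [AT TE Sq cC [yn0 yT]]]]]] := @lomonosov_fixed_point R k X A y0 hA y02.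
  (* Dividing by 8 turns essential norm below 1 and distance below 2 to [8 y0] into the 1/8 and 1/4
     that [lomonosov_fixed_point] asks for. *)
  move=> y yn0; have : closure (essential_orbit A y) (of_real k 8 *: y0).
    by apply: contrapT => nc; apply: dense; exists y, (of_real k 8 *: y0).
  move=> /closure_rnormP/(_ 2 (ltr0Sn _ _))[_ [T [C [AT cC TC ->]]] h].
  have s8 : 0 < (8 : R)^-1 by rewrite invr_gt0.
  exists (of_real k 8^-1 *: T), (of_real k 8^-1 *: C); split.
  - exact: algebraZ.
  - exact: compact_operatorZ.
  - by rewrite -scalerBr rnormZr gtr0_norm// ler_piMr ?ltW.
  - rewrite rdistC (_ : y0 - _ = of_real k 8^-1 *: (of_real k 8 *: y0 - adjoint T y)).
      by rewrite rnormZr gtr0_norm//; lra.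
    rewrite scalerBr scalerA -rcM mulVf ?pnatr_eq0// rc1 scale1r; congr (_ - _).
    by apply: op_eq => x; rewrite [LHS](opZ y).
have lt1 : (8^-1 : R) < 1 by rewrite invf_lt1// ltr1n.
have [L [AL Lfr L0]] := fixed_functional_finite_rank hA hcl AT TE lt1 Sq cC yn0 yT.
by apply: L0; exact: hfr.
Qed.
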